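(* Let $\alpha_1,\beta_1,\alpha_2,\beta_2\in L^\infty$. Then $S_{\alpha_1,\beta_1}$ commutes with $S_{\alpha_2,\beta_2}$ if and only if at least one of the following holds: (i) $\alpha_1,\alpha_2$ are analytic and $\beta_1,\beta_2$ are co-analytic. (ii) $\alpha_1=\beta_1$ and $\alpha_2=\beta_2$. (iii) There are constants $a,b,c\in\mathbb{C}$, with at least one of $a$ and $b$ nonzero, such that $a\alpha_1+b\alpha_2=a\beta_1+b\beta_2=c$.
   Context: $S^1=\{z\in\mathbb{C}:|z|=1\}$ carries normalized Lebesgue measure; $L^2=L^2(S^1)$, $L^\infty=L^\infty(S^1)$ (complex-valued functions, equality meaning a.e.). $H^2$ is the Hardy space of all $f\in L^2$ whose negative Fourier coefficients vanish, and $H^{2\bot}$ is its orthogonal complement in $L^2$. $P$ and $Q=I-P$ are the orthogonal projections of $L^2$ onto $H^2$ and $H^{2\bot}$. For $\alpha,\beta\in L^\infty$, the operator $S_{\alpha,\beta}$ on $L^2$ is $S_{\alpha,\beta}f=\alpha Pf+\beta Qf$. A function in $L^2$ is analytic if it lies in $H^2$, and co-analytic if its complex conjugate is analytic. *)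

(* Defs.v *)
From HB Require Import structures.
From mathcomp Require Import all_boot all_order all_algebra.
From mathcomp Require Import complex.
From mathcomp Require Import all_classical all_reals all_analysis.
From mathcomp Require Import measurable_realfun.

Set Implicit Arguments.
Unset Strict Implicit.
Unset Printing Implicit Defensive.

Import Order.TTheory GRing.Theory Num.Theory.
Import numFieldNormedType.Exports.

Local Open Scope classical_set_scope.
Local Open Scope ring_scope.

Definition circle (R : realType) : Type := {z : R[i] | `|z| == 1}.

HB.instance Definition _ (R : realType) :=
  Choice.copy (circle R) {z : R[i] | `|z| == 1}.

Lemma expi_subproof (R : realType) (t : R) :
  `|(cos (2 * pi * t) +i* sin (2 * pi * t))%C| == 1.
Proof. by rewrite normc_def/= cos2Dsin2 sqrtr1. Qed.

(* t |-> e^(2 i pi t).  The source is measurableTypeR R, i.e. R as the domain of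
   lebesgue_measure: same measurable sets as R, but another display. *)
Definition expi (R : realType) (t : measurableTypeR R) : circle R :=
  exist _ (cos (2 * pi * (t : R)) +i* sin (2 * pi * (t : R)))%C
    (expi_subproof (t : R)).

HB.instance Definition _ (R : realType) :=
  isPointed.Build (circle R) (expi (0 : R)).

(* The measurable sets of S^1 are its Borel sets, i.e. the traces of the Borel
   sets of C = R^2. *)
Definition circle_ReIm (R : realType) (z : circle R) : R * R :=
  (complex.Re (val z), complex.Im (val z)).

HB.instance Definition _ (R : realType) :=
  Measurable.copy (circle R) (g_sigma_algebra_preimageType (@circle_ReIm R)).

Lemma measurable_expi (R : realType) :
  measurable_fun [set: measurableTypeR R] (@expi R).
Proof.
have mlin : measurable_fun [set: R] (fun t : R => 2 * pi * t : R).
  exact: mulrl_measurable.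
have mcs : measurable_fun [set: R]
    (fun t : R => (cos (2 * pi * t), sin (2 * pi * t))).
  apply: measurable_fun_pair; apply: (measurableT_comp _ mlin);
    apply: continuous_measurable_fun.
    exact: continuous_cos.
  exact: continuous_sin.
by move=> _ _ [B mB <-]; rewrite [X in _ `&` (_ @^-1` X)]setTI; exact: mcs.
Qed.

HB.instance Definition _ (R : realType) :=
  isMeasurableFun.Build _ _ (measurableTypeR R) (circle R) (@expi R)
    (@measurable_expi R).

(* Normalized Lebesgue measure on S^1: the law of e^(2 i pi t) for t uniform on
   [0, 1]. *)
Definition circle_measure (R : realType) : probability (circle R) R :=
  distribution (uniform_prob (@ltr01 R)) (@expi R).

Definition cabs (R : realType) (w : R[i]) : R := complex.Re `|w|.

Definition cmeasurable (R : realType) (f : circle R -> R[i]) : Prop :=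
  measurable_fun [set: circle R] (fun z => complex.Re (f z)) /\
  measurable_fun [set: circle R] (fun z => complex.Im (f z)).

(* An element of L^p is represented by a function; two representatives are
   compared by equality almost everywhere. *)
Definition Lp (R : realType) (p : \bar R) : set (circle R -> R[i]) :=
  [set f | cmeasurable f /\
    finite_norm (circle_measure R) p (fun z => cabs (f z))].

Definition L2 (R : realType) : set (circle R -> R[i]) := Lp 2%:E.

Definition Linfty (R : realType) : set (circle R -> R[i]) := Lp +oo%E.

Definition cintegral (R : realType) (f : circle R -> R[i]) : R[i] :=
  ((\int[circle_measure R]_z complex.Re (f z)) +i*
   (\int[circle_measure R]_z complex.Im (f z)))%C.

Definition inner (R : realType) (f g : circle R -> R[i]) : R[i] :=
  cintegral (fun z => f z * (g z)^*%C).

Definition fourier (R : realType) (f : circle R -> R[i]) (n : int) : R[i] :=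
  cintegral (fun z => f z * val z ^ (- n)).

Definition H2 (R : realType) : set (circle R -> R[i]) :=
  [set f | L2 f /\ forall n : int, n < 0 -> fourier f n = 0].

Definition orthocompl (R : realType) (V : set (circle R -> R[i])) :
    set (circle R -> R[i]) :=
  [set g | L2 g /\ forall f, V f -> inner f g = 0].

(* A representative p of the orthogonal projection of f on V: p is in V and
   f - p is orthogonal to V, which determines p almost everywhere.  The default
   value 0 is used only if there is no such p. *)
Definition orthoproj (R : realType) (V : set (circle R -> R[i]))
    (f : circle R -> R[i]) : circle R -> R[i] :=
  xget (fun=> 0) [set p | V p /\ orthocompl V (fun z => f z - p z)].

Definition P (R : realType) (f : circle R -> R[i]) : circle R -> R[i] :=
  orthoproj (@H2 R) f.

(* Q = I - P, the orthogonal projection on the orthogonal complement of H2. *)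
Definition Q (R : realType) (f : circle R -> R[i]) : circle R -> R[i] :=
  fun z => f z - P f z.

Definition singular_op (R : realType) (alpha beta f : circle R -> R[i]) :
    circle R -> R[i] :=
  fun z => alpha z * P f z + beta z * Q f z.

Definition commute_on_L2 (R : realType)
    (S T : (circle R -> R[i]) -> circle R -> R[i]) : Prop :=
  forall f, L2 f -> S (T f) = T (S f) %[ae circle_measure R].

Definition analytic (R : realType) (f : circle R -> R[i]) : Prop := H2 f.

Definition coanalytic (R : realType) (f : circle R -> R[i]) : Prop :=
  analytic (fun z => (f z)^*%C).

(* Main.v *)
(** Write [d = alpha - beta], [p = P f], [q = Q f].  Expanding the composition
    shows that [S_1] and [S_2] commute if and only if [d_1 E_2 f = d_2 E_1 f] for
    all [f], where [E_i f = P (beta_i q) - Q (alpha_i p)] is the defect of [S_i].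
    Since [P (z g)] and [z P g] differ by a constant function, a Fourier
    coefficient of [g], the defects at two consecutive exponentials differ by a
    negative coefficient of [alpha_i] or a positive one of [beta_i], up to the
    factor [z].  So commutation forces [d_1 c_2 = d_2 c_1] for each such pair
    [(c_1, c_2)] of coefficients.  Either all pairs vanish, or all of them are
    proportional to one nonzero pair unless [d_1 = d_2 = 0]; then
    [a = c_2], [b = - c_1] make [a alpha_1 + b alpha_2] both analytic and
    co-analytic, hence constant.

    This needs the existence of the projection (completeness of [L^2]) and the
    completeness of the Fourier system. *)

Require Import Defs.
From mathcomp Require Import all_boot all_order all_algebra.
From mathcomp Require Import complex ring lra.
From mathcomp Require Import all_classical all_reals all_analysis.
From mathcomp Require Import measurable_realfun.

Set Implicit Arguments.
Unset Strict Implicit.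
Unset Printing Implicit Defensive.

Import Order.TTheory GRing.Theory Num.Theory.
Import numFieldNormedType.Exports.
Local Open Scope classical_set_scope.
Local Open Scope ring_scope.

(** * Completeness of L^2 *)

(** Sufficiency uses the same identity: the defects vanish in (i), the differences [d_i] in (ii),
    and in (iii) the nonzero row [(a, b)] annihilates both [(d_1, d_2)] and [(E_1 f, E_2 f)], so
    these two pairs are proportional. Necessity tests commutation on exponentials only. Two
    consecutive exponents give a relation when both exponentials lie in H2 or both in its
    complement; the exponents -1 and 0 straddle the boundary, so the zeroth coefficients never
    enter, and this is the constant left over in (iii). [P f] is a chosen representative, so
    equations between projections hold only almost everywhere and are checked on Fourier
    coefficients; this is where the completeness of the Fourier system is used. It comes from an
    annihilator argument: a function with vanishing coefficients integrates to zero over every Borel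
    set, because multiplying it by Re z or Im z, hence by polynomials in them and by their bounded
    limits, keeps the coefficients zero. *)

Section L2_completeness.
Context d (T : measurableType d) (R : realType) (mu : probability T R).
Variable u : nat -> T -> R.
Hypothesis mu_ : forall n, measurable_fun [set: T] (u n).
Hypothesis cauchy_u : forall n m, (n <= m)%N ->
  (\int[mu]_x ((u m x - u n x) ^+ 2)%:E <= ((4 ^+ n)^-1)%:E)%E.

Let jump n x : R := `|u n.+1 x - u n x|.

Let mjump n : measurable_fun [set: T] (EFin \o jump n).
Proof.
by apply/measurable_EFinP; apply: measurableT_comp => //; exact: measurable_funB.
Qed.

(** Instead of Cauchy-Schwarz: [t <= (2^n / 2) t^2 + 2^-n / 2], with weights for which either term
    contributes [2^-n / 2] on a probability space. *)
Let int_jump n : (\int[mu]_x (jump n x)%:E <= ((2 ^+ n)^-1)%:E)%E.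
Proof.
have mdiff : measurable_fun [set: T] (fun x => (u n.+1 x - u n x) ^+ 2).
  by apply: measurable_funX; exact: measurable_funB.
have -> : (2 ^+ n : R)^-1 = 2 ^+ n / 2 * (4 ^+ n)^-1 + (2 ^+ n)^-1 / 2.
  have -> : (4 : R) = 2 ^+ 2 by rewrite -natrX.
  by rewrite exprAC; field; rewrite expf_neq0.
apply: (@le_trans _ _ (\int[mu]_x ((2 ^+ n / 2)%:E * ((u n.+1 x - u n x) ^+ 2)%:E
    + ((2 ^+ n)^-1 / 2)%:E))%E).
  apply: ge0_le_integral => //.
  - by move=> x _; rewrite lee_fin normr_ge0.
  - exact: mjump.
  - by apply: emeasurable_funD => //; apply: measurable_funeM; exact/measurable_EFinP.
  move=> x _; rewrite /jump -EFinM -EFinD lee_fin.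
  rewrite -[_ ^+ 2](@real_normK _ _) ?num_real//.
  set t := `|_|; have t2 : (2 : R) ^+ n != 0 by rewrite expf_neq0.
  rewrite -subr_ge0.
  have -> : 2 ^+ n / 2 * t ^+ 2 + (2 ^+ n)^-1 / 2 - t
      = (2 ^+ n)^-1 / 2 * (2 ^+ n * t - 1) ^+ 2 by field.
  by rewrite mulr_ge0 ?sqr_ge0// divr_ge0// invr_ge0 exprn_ge0.
rewrite ge0_integralD//=; last 2 first.
- by move=> x _; rewrite -EFinM lee_fin mulr_ge0 ?sqr_ge0// divr_ge0// exprn_ge0.
- by apply: measurable_funeM; exact/measurable_EFinP.
rewrite ge0_integralZl//=; last 2 first.
- exact/measurable_EFinP.
- by move=> x _; rewrite lee_fin sqr_ge0.
have -> : (\int[mu]__ ((2 ^+ n)^-1 / 2 : R)%:E = ((2 ^+ n)^-1 / 2 : R)%:E)%E.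
  rewrite -[RHS]mule1 -(@probability_setT _ _ _ mu); exact: integral_cst.
rewrite EFinD leeD2r// [leRHS]EFinM lee_wpmul2l ?cauchy_u//.
Qed.

(** An upper limit exists and is measurable everywhere, so the null set where [u] diverges needs no
    separate treatment; [fine] makes the values finite. *)
Let v x := fine (limn_esup (fun n => (u n x)%:E)).

Let mv : measurable_fun [set: T] v.
Proof.
apply: (measurableT_comp (fine_measurable measurableT)) => //.
by apply: measurable_fun_limn_esup => n; exact/measurable_EFinP.
Qed.

(** The sum of the jumps has finite integral, hence is finite almost everywhere, and there the
    telescoping series of [u] converges absolutely. *)
Let cvg_u : {ae mu, forall x, u n x @[n --> \oo] --> v x}.
Proof.
have int_sum : (\int[mu]_x (\sum_(n <oo) (jump n x)%:E) < +oo)%E.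
  rewrite integral_nneseries//; last by move=> n x _; rewrite lee_fin normr_ge0.
  (* [2 / 2^(n+1)] is [2^-n], in the shape that [epsilon_trick] sums to at most 2. *)
  apply: (@le_lt_trans _ _ (\sum_(n <oo) (0 + (2 / (2 ^ n.+1)%:R)%:E))%E).
    apply: lee_nneseries => n _.
      by move=> _; apply: integral_ge0 => x _; rewrite lee_fin normr_ge0.
    apply: (le_trans (int_jump n)); rewrite add0e lee_fin natrX exprS invfM.
    by rewrite mulrA divff// mul1r.
  apply: (le_lt_trans (@epsilon_trick R (fun=> 0%E) 2 xpredT _ _)) => //.
  by rewrite eseries0// add0e ltry.
have int_f : mu.-integrable [set: T] (fun x => \sum_(n <oo) (jump n x)%:E)%E.
  apply/integrableP; split.
    apply: (@ge0_emeasurable_sum _ _ _ _ (fun n => EFin \o jump n) xpredT).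
      by move=> n x _ _; rewrite lee_fin normr_ge0.
    by move=> n _; exact: mjump.
  rewrite (eq_integral (fun x => \sum_(n <oo) (jump n x)%:E)%E)// => x _.
  by rewrite gee0_abs// nneseries_ge0// => n _ _; rewrite lee_fin normr_ge0.
have := integrable_ae measurableT int_f.
apply: filterS => x /(_ I) fin_sum.
have cvgn_u : cvgn (fun n => u n x).
  have : cvgn (series (telescope (fun n => u n x))).
    apply: normed_cvg => /=.
    apply: nondecreasing_is_cvgn.
      by apply: nondecreasing_series => k _ _ /=; rewrite normr_ge0.
    exists (fine (\sum_(n <oo) (jump n x)%:E)%E) => _ [k _ <-].
    have -> : [normed series (telescope (fun n => u n x))] k =
        \sum_(0 <= i < k) jump i x by rewrite /normed_series_of seriesEnat.
    rewrite -lee_fin fineK// -sumEFin.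
    by apply: nneseries_lim_ge => i _; rewrite lee_fin normr_ge0.
  rewrite telescopeK => /cvg_ex[l ul]; apply/cvg_ex; exists (l + u 0%N x).
  have -> : (fun n => u n x) = (fun n => [sequence u n x - u 0%N x]_n n + u 0%N x).
    by apply/funext => n /=; rewrite subrK.
  by apply: cvgD => //; exact: cvg_cst.
have [l ul] := (cvg_ex _).1 cvgn_u.
have eul : (u n x)%:E @[n --> \oo] --> l%:E by apply: cvg_EFin; [exact: nearW|exact: ul].
by rewrite /v (cvg_limn_einf_sup eul).2.
Qed.

(** Fatou's lemma in [m], with [n] fixed, carries the Cauchy bound to the limit. *)
Lemma L2_complete : exists2 w : T -> R, measurable_fun [set: T] w &
  forall n, (\int[mu]_x ((w x - u n x) ^+ 2)%:E <= ((4 ^+ n)^-1)%:E)%E.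
Proof.
exists v => // n.
have msq m : measurable_fun [set: T] (fun x => ((u m x - u n x) ^+ 2)%:E).
  by apply/measurable_EFinP; apply: measurable_funX; exact: measurable_funB.
have -> : (\int[mu]_x ((v x - u n x) ^+ 2)%:E =
    \int[mu]_x limn_einf (fun m => ((u m x - u n x) ^+ 2)%:E))%E.
  apply: ae_eq_integral => //.
  - by apply/measurable_EFinP; apply: measurable_funX; exact: measurable_funB.
  - apply: measurableT_comp => //; apply: measurable_fun_limn_esup => m.
    exact: measurableT_comp.
  apply: filterS cvg_u => x ux _.
  have e : ((u m x - u n x) ^+ 2)%:E @[m --> \oo] --> ((v x - u n x) ^+ 2)%:E.
    apply: cvg_EFin; first exact: nearW.
    apply: (@cvgM _ _ _ _ (fun m => u m x - u n x) (fun m => u m x - u n x));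
    by apply: cvgB => //; exact: cvg_cst.
  by rewrite (cvg_limn_einf_sup e).1.
apply: (le_trans (fatou mu measurableT msq _)).
  by move=> m x _; rewrite lee_fin sqr_ge0.
rewrite limn_einf_lim; apply: lime_le; first exact: is_cvg_einfs.
apply: nearW => k; apply: ereal_inf_le.
(* The Cauchy bound is available only for indices from [n] on, so the infimum over the tail from [k]
   is bounded by its term of index [maxn k n]. *)
exists (\int[mu]_x ((u (maxn k n) x - u n x) ^+ 2)%:E)%E.
  by exists (maxn k n) => //=; rewrite leq_maxl.
by apply: cauchy_u; rewrite leq_maxr.
Unshelve. all: by end_near. Qed.
End L2_completeness.

(** * Complex-valued square-integrable functions on the circle *)

Section complex_parts.
Context {R : realType}.
Implicit Types (x y : R[i]) (a : R).

Lemma ReD x y : complex.Re (x + y) = complex.Re x + complex.Re y.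
Proof. by case: x; case: y. Qed.

Lemma ImD x y : complex.Im (x + y) = complex.Im x + complex.Im y.
Proof. by case: x; case: y. Qed.

Lemma ReM x y :
  complex.Re (x * y) = complex.Re x * complex.Re y - complex.Im x * complex.Im y.
Proof. by case: x; case: y. Qed.

Lemma ImM x y :
  complex.Im (x * y) = complex.Re x * complex.Im y + complex.Im x * complex.Re y.
Proof. by case: x; case: y. Qed.

Lemma ReN x : complex.Re (- x) = - complex.Re x. Proof. by case: x. Qed.

Lemma ImN x : complex.Im (- x) = - complex.Im x. Proof. by case: x. Qed.

Lemma Re_conj x : complex.Re (x^*)%C = complex.Re x. Proof. by case: x. Qed.

Lemma Im_conj x : complex.Im (x^*)%C = - complex.Im x. Proof. by case: x. Qed.

Lemma complex_inj x y :
  complex.Re x = complex.Re y -> complex.Im x = complex.Im y -> x = y.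
Proof. by case: x => a b; case: y => c e /= -> ->. Qed.

Lemma conjcM x y : (x * y)^*%C = x^*%C * y^*%C.
Proof. exact: rmorphM. Qed.

Lemma conj_conj x : x^*%C^*%C = x.
Proof. by case: x => a b /=; rewrite opprK. Qed.

(** Squared modulus as a real polynomial in the parts: [ring] applies to it and no square root
    enters the integrals. *)
Definition normsq x : R := complex.Re x ^+ 2 + complex.Im x ^+ 2.

Lemma normsq_ge0 x : 0 <= normsq x.
Proof. by rewrite addr_ge0// sqr_ge0. Qed.

Lemma cabs_sqr x : cabs x ^+ 2 = normsq x.
Proof. by rewrite /cabs normc_def/= sqr_sqrtr// normsq_ge0. Qed.

Lemma cabs_ge0 x : 0 <= cabs x.
Proof. by rewrite /cabs normc_def/= sqrtr_ge0. Qed.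

Lemma normsq_eq0 x : normsq x = 0 -> x = 0.
Proof.
move/eqP; rewrite paddr_eq0 ?sqr_ge0// !sqrf_eq0 => /andP[/eqP r0 /eqP i0].
exact: complex_inj.
Qed.

Lemma normsqM x y : normsq (x * y) = normsq x * normsq y.
Proof. by rewrite /normsq ReM ImM; ring. Qed.

Lemma normsq_conj x : normsq (x^*)%C = normsq x.
Proof. by rewrite /normsq Re_conj Im_conj sqrrN. Qed.

Lemma mulc_conj x : x * (x^*)%C = (normsq x)%:C%C.
Proof.
by apply: complex_inj; rewrite ?ReM ?ImM Re_conj Im_conj /normsq/=; ring.
Qed.

Lemma normsqD_le x y : normsq (x + y) <= 2 * normsq x + 2 * normsq y.
Proof.
rewrite -subr_ge0 (_ : _ - _ = normsq (x - y)) ?normsq_ge0//.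
by rewrite /normsq !ReD !ImD ReN ImN; ring.
Qed.

(** Both parts of a complex product have the form [a c - b e] up to a sign. Each of the two
    differences to be shown nonnegative is half a sum of squares. *)
Lemma normr_mul_le (a b c e : R) :
  `|a * c - b * e| <= (a ^+ 2 + b ^+ 2) + (c ^+ 2 + e ^+ 2).
Proof.
rewrite ler_norml -[- _ <= _]subr_ge0 -[_ - _ <= _]subr_ge0.
rewrite (_ : _ - - _ =
  ((a + c) ^+ 2 + (b - e) ^+ 2 + (a ^+ 2 + b ^+ 2) + (c ^+ 2 + e ^+ 2)) / 2);
  last by field.
rewrite (_ : _ - (_ - _) =
  ((a - c) ^+ 2 + (b + e) ^+ 2 + (a ^+ 2 + b ^+ 2) + (c ^+ 2 + e ^+ 2)) / 2);
  last by field.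
by rewrite !divr_ge0 ?addr_ge0 ?sqr_ge0.
Qed.

Lemma normr_ReM_le x y : `|complex.Re (x * y)| <= normsq x + normsq y.
Proof. by rewrite ReM normr_mul_le. Qed.

Lemma normr_ImM_le x y : `|complex.Im (x * y)| <= normsq x + normsq y.
Proof.
rewrite ImM -[_ * complex.Re y]opprK -mulrN.
by rewrite (le_trans (normr_mul_le _ _ _ _))// sqrrN /normsq lerD2l addrC.
Qed.

End complex_parts.

(** * Measurability, integrability and arithmetic of complex functions on the circle *)

Section circle_L2.
Context {R : realType}.
Local Notation mu := (circle_measure R).
Implicit Types (f g h : circle R -> R[i]) (c : R[i]).

Lemma cmeasurable_cst c : cmeasurable (fun=> c : R[i]).
Proof. by split; exact: measurable_cst. Qed.

Lemma cmeasurableD f g : cmeasurable f -> cmeasurable g ->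
  cmeasurable (fun z => f z + g z).
Proof.
move=> [fr fi] [gr gi]; split.
  by under eq_fun do rewrite ReD; exact: measurable_funD.
by under eq_fun do rewrite ImD; exact: measurable_funD.
Qed.

Lemma cmeasurableM f g : cmeasurable f -> cmeasurable g ->
  cmeasurable (fun z => f z * g z).
Proof.
move=> [fr fi] [gr gi]; split.
  by under eq_fun do rewrite ReM; apply: measurable_funB; exact: measurable_funM.
by under eq_fun do rewrite ImM; apply: measurable_funD; exact: measurable_funM.
Qed.

Lemma cmeasurableB f g : cmeasurable f -> cmeasurable g ->
  cmeasurable (fun z => f z - g z).
Proof.
move=> [fr fi] [gr gi]; split.
  by under eq_fun do rewrite ReD ReN; exact: measurable_funB.
by under eq_fun do rewrite ImD ImN; exact: measurable_funB.
Qed.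

Lemma cmeasurable_conj f : cmeasurable f -> cmeasurable (fun z => (f z)^*%C).
Proof.
move=> [fr fi]; split; first by under eq_fun do rewrite Re_conj.
by under eq_fun do rewrite Im_conj; exact: measurableT_comp.
Qed.

Lemma measurable_normsq f : cmeasurable f ->
  measurable_fun [set: circle R] (fun z => normsq (f z)).
Proof. by move=> [fr fi]; apply: measurable_funD; exact: measurable_funX. Qed.

Lemma measurable_ReIm : measurable_fun [set: circle R] (@circle_ReIm R).
Proof. by move=> _ B mB; rewrite setTI; exists B => //; rewrite setTI. Qed.

Lemma cmeasurable_val : cmeasurable (fun z : circle R => val z).
Proof.
split; first exact: (measurableT_comp measurable_fst measurable_ReIm).
exact: (measurableT_comp measurable_snd measurable_ReIm).
Qed.

Definition cintegrable f :=
  mu.-integrable [set: circle R] (EFin \o (fun z => complex.Re (f z))) /\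
  mu.-integrable [set: circle R] (EFin \o (fun z => complex.Im (f z))).

Definition sqint f :=
  mu.-integrable [set: circle R] (EFin \o (fun z => normsq (f z))).

(** Trades the [Lp] norm for the integral of [normsq], the form in which square integrability is
    handled from here on. *)
Lemma L2P f : L2 f <-> cmeasurable f /\ sqint f.
Proof.
have e : (\int[mu]_z (`|normsq (f z)|%:E) = 'N[mu]_2%:E[EFin \o (fun z => cabs (f z))] `^ 2)%E.
  rewrite powR_Lnorm//; apply: eq_integral => z _ /=.
  by rewrite ger0_norm ?normsq_ge0// ger0_norm ?cabs_ge0// powR_mulrn ?cabs_ge0// cabs_sqr.
split=> -[mf].
  move=> fn; split=> //; apply/integrableP; split.
    by apply/measurable_EFinP; exact: measurable_normsq.
  by rewrite [ltLHS]e poweR_lty.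
move=> /integrableP[_]; rewrite [ltLHS]e => lty; split => //.
rewrite /finite_norm ltey; apply: contraTN lty => /eqP ->.
by rewrite -leNgt poweRyr.
Qed.

Lemma cintegrableM f g : L2 f -> L2 g -> cintegrable (fun z => f z * g z).
Proof.
move=> /L2P[mf If] /L2P[mg Ig]; have [mr mi] := cmeasurableM mf mg.
have Ifg := integrableD measurableT If Ig.
split; apply: (le_integrable measurableT _ _ Ifg).
- exact/measurable_EFinP.
- move=> z _ /=; rewrite lee_fin [leRHS]ger0_norm; last first.
    exact: addr_ge0 (normsq_ge0 _) (normsq_ge0 _).
  exact: normr_ReM_le.
- exact/measurable_EFinP.
- move=> z _ /=; rewrite lee_fin [leRHS]ger0_norm; last first.
    exact: addr_ge0 (normsq_ge0 _) (normsq_ge0 _).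
  exact: normr_ImM_le.
Qed.

Lemma cintegralD f g : cintegrable f -> cintegrable g ->
  cintegral (fun z => f z + g z) = cintegral f + cintegral g.
Proof.
move=> [fr fi] [gr gi]; apply: complex_inj; rewrite ?ReD ?ImD /=.
  by under eq_Rintegral do rewrite ReD; rewrite RintegralD.
by under eq_Rintegral do rewrite ImD; rewrite RintegralD.
Qed.

Lemma cintegrableZ c f : cintegrable f -> cintegrable (fun z => c * f z).
Proof.
move=> [fr fi]; have Zr k := integrableZl measurableT k fr.
have Zi k := integrableZl measurableT k fi; split.
  apply: eq_integrable (integrableB measurableT (Zr (complex.Re c)) (Zi (complex.Im c))) => //.
  by move=> z _ /=; rewrite ReM.
apply: eq_integrable (integrableD measurableT (Zi (complex.Re c)) (Zr (complex.Im c))) => //.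
by move=> z _ /=; rewrite ImM.
Qed.

Lemma cintegralZ c f : cintegrable f ->
  cintegral (fun z => c * f z) = c * cintegral f.
Proof.
move=> [fr fi]; have Zr k := integrableZl measurableT k fr.
have Zi k := integrableZl measurableT k fi.
apply: complex_inj; rewrite ?ReM ?ImM /=.
  under eq_Rintegral do rewrite ReM.
  rewrite (RintegralB measurableT (Zr _) (Zi _)).
  by rewrite (RintegralZl _ measurableT fr) (RintegralZl _ measurableT fi).
under eq_Rintegral do rewrite ImM.
rewrite (RintegralD measurableT (Zi _) (Zr _)).
by rewrite (RintegralZl _ measurableT fr) (RintegralZl _ measurableT fi).
Qed.

Lemma cintegral_conj f : cintegrable f ->
  cintegral (fun z => (f z)^*%C) = (cintegral f)^*%C.
Proof.
move=> [fr fi]; apply: complex_inj; rewrite ?Re_conj ?Im_conj/=.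
  by apply: eq_Rintegral => z _; rewrite Re_conj.
under eq_Rintegral do rewrite Im_conj -mulN1r.
by rewrite RintegralZl// mulN1r.
Qed.

Lemma eq_cintegral f g : f =1 g -> cintegral f = cintegral g.
Proof. by move=> /funext ->. Qed.

Lemma ae_eq_cintegral f g : cmeasurable f -> cmeasurable g ->
  f = g %[ae mu] -> cintegral f = cintegral g.
Proof.
move=> [fr fi] [gr gi] fg; congr (_ +i* _)%C; congr fine; apply: ae_eq_integral => //;
  try exact/measurable_EFinP.
  by apply: filterS fg => z /(_ I) + _ => ->.
by apply: filterS fg => z /(_ I) + _ => ->.
Qed.

Lemma L2_cmeasurable f : L2 f -> cmeasurable f. Proof. by case. Qed.

Lemma L2D f g : L2 f -> L2 g -> L2 (fun z => f z + g z).
Proof.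
move=> /L2P[mf If] /L2P[mg Ig]; apply/L2P; split; first exact: cmeasurableD.
apply: (le_integrable measurableT _ _ (integrableD measurableT
  (integrableZl measurableT 2 If) (integrableZl measurableT 2 Ig))).
  by apply/measurable_EFinP/measurable_normsq/cmeasurableD.
move=> z _ /=; rewrite lee_fin !ger0_norm ?normsq_ge0//.
  exact: normsqD_le.
by rewrite addr_ge0 ?mulr_ge0 ?normsq_ge0.
Qed.

Lemma L2Z c f : L2 f -> L2 (fun z => c * f z).
Proof.
move=> /L2P[mf If]; apply/L2P; split.
  by apply: cmeasurableM => //; exact: cmeasurable_cst.
apply: eq_integrable (integrableZl measurableT (normsq c) If) => // z _ /=.
by rewrite normsqM.
Qed.

Lemma L2B f g : L2 f -> L2 g -> L2 (fun z => f z - g z).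
Proof.
move=> Lf Lg; have := L2D Lf (L2Z (-1) Lg).
by under eq_fun do rewrite mulN1r.
Qed.

Lemma L2_conj f : L2 f -> L2 (fun z => (f z)^*%C).
Proof.
move=> /L2P[mf If]; apply/L2P; split; first exact: cmeasurable_conj.
by apply: eq_integrable If => // z _ /=; rewrite normsq_conj.
Qed.

Lemma L2_cst c : L2 (fun=> c : R[i]).
Proof.
apply/L2P; split; first exact: cmeasurable_cst.
exact: (finite_measure_integrable_cst mu (normsq c)).
Qed.

Lemma Linfty_bounded f : Linfty f ->
  exists M : R, \forall z \ae mu, normsq (f z) <= M.
Proof.
(* The norm at [+oo] is an essential supremum only if the whole space has positive measure; [T1]
   selects that branch. *)
have T1 : (0 < mu [set: circle R])%E by rewrite (@probability_setT _ _ _ mu) lte01.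
move=> [mf]; rewrite /finite_norm unlock.
rewrite -[X in (X < _)%E]/(if (0 < mu [set: circle R])%E then _ else _) T1.
move=> /ess_sup_inf.ess_supr_bounded[M HM]; exists (M ^+ 2); apply: filterS HM => z /= zM.
rewrite -cabs_sqr ler_sqr ?nnegrE ?cabs_ge0//.
- by apply: le_trans zM; rewrite ler_norm.
by apply: le_trans zM; rewrite normr_ge0.
Qed.

Lemma L2M_Linfty f g : Linfty f -> L2 g -> L2 (fun z => f z * g z).
Proof.
move=> Lf /L2P[mg Ig]; have mf : cmeasurable f by case: Lf.
have [M fM] := Linfty_bounded Lf.
apply/L2P; split; first exact: cmeasurableM.
have /integrableP[_ MIg] := integrableZl measurableT M Ig.
apply/integrableP; split.
  by apply/measurable_EFinP/measurable_normsq/cmeasurableM.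
(* The bound on [f] holds only almost everywhere, so the pointwise comparison [le_integrable] does
   not apply. *)
apply: le_lt_trans MIg; apply: ae_ge0_le_integral => //.
- apply: measurableT_comp => //.
  by apply/measurable_EFinP/measurable_normsq/cmeasurableM.
- apply: measurableT_comp => //; apply: measurable_funeM.
  by apply/measurable_EFinP/measurable_normsq.
apply: filterS fM => z fM _ /=; rewrite lee_fin normsqM.
by rewrite !normrM ler_wpM2r// ger0_norm ?normsq_ge0// (le_trans fM)// ler_norm.
Qed.

Lemma Linfty_L2 f : Linfty f -> L2 f.
Proof.
move=> /L2M_Linfty /(_ (L2_cst 1)).
by under eq_fun do rewrite mulr1.
Qed.

End circle_L2.

(** * Orthogonal projections *)

Section circle_hilbert.
Context {R : realType}.
Local Notation mu := (circle_measure R).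
Implicit Types (f g h p : circle R -> R[i]) (a b c : R[i]).

Definition sqnorm f : R := \int[mu]_z normsq (f z).

Lemma sqnorm_ge0 f : 0 <= sqnorm f.
Proof. by apply: Rintegral_ge0 => z _; exact: normsq_ge0. Qed.

Lemma L2_sqint f : L2 f -> mu.-integrable [set: circle R] (EFin \o (fun z => normsq (f z))).
Proof. by move=> /L2P[]. Qed.

Lemma EFin_sqnorm f : L2 f -> (\int[mu]_z (normsq (f z))%:E = (sqnorm f)%:E)%E.
Proof. by move=> /L2_sqint If; rewrite /sqnorm /Rintegral fineK// integrable_fin_num. Qed.

Lemma cintegrable_inner f g : L2 f -> L2 g -> cintegrable (fun z => f z * (g z)^*%C).
Proof. by move=> Lf Lg; apply: cintegrableM => //; exact: L2_conj. Qed.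

Lemma inner_linear a b f g h : L2 f -> L2 g -> L2 h ->
  inner (fun z => a * f z + b * g z) h = a * inner f h + b * inner g h.
Proof.
move=> Lf Lg Lh; have If := cintegrable_inner Lf Lh.
have Ig := cintegrable_inner Lg Lh.
rewrite /inner -!cintegralZ// -cintegralD//; last 2 first.
  exact: cintegrableZ.
  exact: cintegrableZ.
by apply: eq_cintegral => z; rewrite mulrDl !mulrA.
Qed.

Lemma innerB f g h : L2 f -> L2 g -> L2 h ->
  inner (fun z => f z - g z) h = inner f h - inner g h.
Proof.
move=> Lf Lg Lh; have := inner_linear 1 (-1) Lf Lg Lh.
by rewrite mul1r mulN1r => <-; apply: eq_cintegral => z; rewrite mul1r mulN1r.
Qed.

Lemma inner_conj f g : L2 f -> L2 g -> inner g f = ((inner f g)^*)%C.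
Proof.
move=> Lf Lg; rewrite /inner -cintegral_conj; last exact: cintegrable_inner.
by apply: eq_cintegral => z; rewrite conjcM conj_conj mulrC.
Qed.

Lemma inner_self f : inner f f = (sqnorm f)%:C%C.
Proof.
apply: complex_inj => /=; first by apply: eq_Rintegral => z _; rewrite mulc_conj.
rewrite (eq_Rintegral _ (g := fun=> 0)) => [|z _]; last by rewrite mulc_conj.
by rewrite Rintegral_cst// mul0r.
Qed.

Lemma sqnormB_scale f h c : L2 f -> L2 h ->
  sqnorm (fun z => f z - c * h z) =
  sqnorm f - 2 * complex.Re ((c^*)%C * inner f h) + normsq c * sqnorm h.
Proof.
move=> Lf Lh; have Lch := L2Z c Lh; have Lfch := L2B Lf Lch.
have e g : L2 g -> inner (fun z => f z - c * h z) g = inner f g - c * inner h g.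
  move=> Lg; rewrite innerB//; congr (_ - _).
  have := inner_linear c 0 Lh Lh Lg; rewrite mul0r addr0 => <-.
  by apply: eq_cintegral => z; rewrite mul0r addr0.
apply: complexI; rewrite /= -inner_self e//.
rewrite (inner_conj Lfch Lf) (inner_conj Lfch Lh) !e//.
rewrite !inner_self (inner_conj Lf Lh).
apply: complex_inj; rewrite ?(ReD, ImD, ReN, ImN, ReM, ImM, Re_conj, Im_conj)/=;
  rewrite ?(ReD, ImD, ReN, ImN, ReM, ImM, Re_conj, Im_conj)/= /normsq; ring.
Qed.

(* The choice [c = <f, h> / (1 + |h|^2)] avoids a case distinction on
   whether [h] vanishes. *)
Lemma inner_le_of_minimal f h (m : R) : L2 f -> L2 h ->
  (forall c, m <= sqnorm (fun z => f z - c * h z)) ->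
  normsq (inner f h) <= (1 + sqnorm h) * (sqnorm f - m).
Proof.
move=> Lf Lh minm; set w := inner f h; set N := sqnorm h.
have N0 : 0 <= N by exact: sqnorm_ge0.
have N1 : 0 < 1 + N by rewrite ltr_pwDl.
have N1' : 1 + N != 0 by rewrite gt_eqF.
have := minm (((1 + N)^-1)%:C%C * w).
rewrite sqnormB_scale// -/w -/N normsqM conjcM.
rewrite (_ : complex.Re _ = (1 + N)^-1 * normsq w); last first.
  by rewrite -mulrA [_^*%C * w]mulrC mulc_conj ReM/=; rewrite /normsq/=; ring.
rewrite (_ : normsq ((1 + N)^-1)%:C%C = (1 + N)^-2); last first.
  by rewrite /normsq/= expr0n addr0 exprVn.
have w0 := normsq_ge0 w.
rewrite -subr_ge0 => H; rewrite -subr_ge0.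
rewrite (_ : _ - _ = (1 + N) * (sqnorm f - 2 * ((1 + N)^-1 * normsq w) +
    (1 + N)^-2 * normsq w * N - m) + normsq w / (1 + N)).
  by rewrite addr_ge0 ?divr_ge0 ?mulr_ge0 // ltW.
by field.
Qed.

(** The case [m = 0] of the previous lemma. The factor [1 + sqnorm h] is as good as the sharp one,
    since the inequality only serves to let errors tend to 0. *)
Lemma cauchy_schwarz f h : L2 f -> L2 h ->
  normsq (inner f h) <= (1 + sqnorm h) * sqnorm f.
Proof.
move=> Lf Lh; rewrite -[sqnorm f]subr0; apply: inner_le_of_minimal => // c.
exact: sqnorm_ge0.
Qed.

(** The law for the vectors [f - p] and [f - q], their sum being twice the vector from the midpoint
    of [p] and [q] to [f]. The midpoint stays in any subspace that contains [p] and [q]. *)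
Lemma parallelogram f p q : L2 f -> L2 p -> L2 q ->
  sqnorm (fun z => p z - q z) + 4 * sqnorm (fun z => f z - (2^-1 * p z + 2^-1 * q z)) =
  2 * sqnorm (fun z => f z - p z) + 2 * sqnorm (fun z => f z - q z).
Proof.
move=> Lf Lp Lq.
have I1 := L2_sqint (L2B Lp Lq).
have I2 := L2_sqint (L2B Lf (L2D (L2Z 2^-1 Lp) (L2Z 2^-1 Lq))).
have I3 := L2_sqint (L2B Lf Lp).
have I4 := L2_sqint (L2B Lf Lq).
rewrite /sqnorm -!(RintegralZl _ measurableT)//.
have Z (k : R) (g : circle R -> R) (Ig : mu.-integrable [set: circle R] (EFin \o g)) := integrableZl measurableT k Ig.
rewrite -(RintegralD measurableT I1 (Z _ _ I2)).
rewrite -(RintegralD measurableT (Z _ _ I3) (Z _ _ I4)).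
apply: eq_Rintegral => z _; move: (f z) (p z) (q z) => [a1 a2] [b1 b2] [c1 c2].
have h2 : (2^-1 : R[i]) = (2^-1 : R)%:C%C by rewrite fmorphV rmorph_nat.
by rewrite h2 /normsq !(ReD, ImD, ReN, ImN, ReM, ImM)/=; field.
Qed.

Lemma le_pow4_eq0 (x K : R) : 0 <= K -> (forall n, x <= K * (4 ^+ n)^-1) -> x <= 0.
Proof.
move=> K0 H; rewrite leNgt; apply/negP => x0.
have /archi_boundP : 0 <= K / x by rewrite divr_ge0// ltW.
set n := Num.bound _; rewrite ltr_pdivrMr// => Kn.
have := H n; rewrite ler_pdivlMr ?exprn_gt0// leNgt => /negP; apply.
rewrite (lt_le_trans Kn)// mulrC ler_wpM2l ?(ltW x0)//.
by rewrite -natrX ler_nat ltnW// ltn_expl.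
Qed.

(** Real completeness applied to the real and the imaginary parts; each contributes [4^-n], whence
    the factor 2. *)
Lemma L2_cauchy_cvg (u : nat -> circle R -> R[i]) : (forall n, L2 (u n)) ->
  (forall n m, (n <= m)%N -> sqnorm (fun z => u m z - u n z) <= (4 ^+ n)^-1) ->
  exists2 w, L2 w & forall n, sqnorm (fun z => w z - u n z) <= 2 * (4 ^+ n)^-1.
Proof.
move=> Lu cu; have mu_ n := L2_cmeasurable (Lu n).
have cauchy_re n m : (n <= m)%N ->
    (\int[mu]_z ((complex.Re (u m z) - complex.Re (u n z)) ^+ 2)%:E <= ((4 ^+ n)^-1)%:E)%E.
  move=> /cu; rewrite -lee_fin -EFin_sqnorm; last exact: L2B.
  apply: le_trans; apply: ge0_le_integral => //.
  - by move=> z _; rewrite lee_fin sqr_ge0.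
  - apply/measurable_EFinP/measurable_funX/measurable_funB.
      exact: (mu_ m).1.
    exact: (mu_ n).1.
  - by apply/measurable_EFinP/measurable_normsq/cmeasurableB.
  - by move=> z _; rewrite lee_fin /normsq ReD ReN lerDl sqr_ge0.
have cauchy_im n m : (n <= m)%N ->
    (\int[mu]_z ((complex.Im (u m z) - complex.Im (u n z)) ^+ 2)%:E <= ((4 ^+ n)^-1)%:E)%E.
  move=> /cu; rewrite -lee_fin -EFin_sqnorm; last exact: L2B.
  apply: le_trans; apply: ge0_le_integral => //.
  - by move=> z _; rewrite lee_fin sqr_ge0.
  - apply/measurable_EFinP/measurable_funX/measurable_funB.
      exact: (mu_ m).2.
    exact: (mu_ n).2.
  - by apply/measurable_EFinP/measurable_normsq/cmeasurableB.
  - by move=> z _; rewrite lee_fin /normsq ImD ImN lerDr sqr_ge0.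
have [wr mwr wrP] := L2_complete (fun n => (mu_ n).1) cauchy_re.
have [wi mwi wiP] := L2_complete (fun n => (mu_ n).2) cauchy_im.
pose w z : R[i] := (wr z +i* wi z)%C.
have mw : cmeasurable w by [].
have wu n : (\int[mu]_z (normsq (w z - u n z))%:E <= (2 * (4 ^+ n)^-1)%:E)%E.
  rewrite (eq_integral (fun z => ((wr z - complex.Re (u n z)) ^+ 2)%:E +
      ((wi z - complex.Im (u n z)) ^+ 2)%:E))%E; last first.
    by move=> z _; rewrite /normsq ReD ReN ImD ImN EFinD.
  have msq (v : circle R -> R) (v' : circle R -> R) :
      measurable_fun [set: circle R] v -> measurable_fun [set: circle R] v' ->
      measurable_fun [set: circle R] (fun z => ((v z - v' z) ^+ 2)%:E).
    by move=> mv mv'; apply/measurable_EFinP/measurable_funX/measurable_funB.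
  rewrite ge0_integralD//; last 4 first.
  - by move=> z _; rewrite lee_fin sqr_ge0.
  - by apply: msq => //; exact: (mu_ n).1.
  - by move=> z _; rewrite lee_fin sqr_ge0.
  - by apply: msq => //; exact: (mu_ n).2.
  by rewrite mulr_natl mulr2n EFinD leeD.
have Lwu n : L2 (fun z => w z - u n z).
  apply/L2P; split; first exact: cmeasurableB.
  apply/integrableP; split.
    by apply/measurable_EFinP/measurable_normsq/cmeasurableB.
  under eq_integral do rewrite /= ger0_norm ?normsq_ge0//.
  by rewrite (le_lt_trans (wu n))// ltry.
exists w => [|n]; last by rewrite -lee_fin -EFin_sqnorm.
have := L2D (Lwu 0%N) (Lu 0%N).
by under eq_fun do rewrite subrK.
Qed.

(** Closedness of [V] is asked along sequences converging at the rate that [L2_cauchy_cvg] delivers,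
    which avoids a topology on L^2. A minimizing sequence is Cauchy by the parallelogram law. *)
Lemma ex_orthogonal_projection (V : set (circle R -> R[i])) f :
    V `<=` @L2 R -> V !=set0 ->
    (forall a b p q, V p -> V q -> V (fun z => a * p z + b * q z)) ->
    (forall u w, (forall n : nat, V (u n)) -> L2 w ->
      (forall n, sqnorm (fun z => w z - u n z) <= 2 * (4 ^+ n)^-1) -> V w) ->
    L2 f ->
  exists p, V p /\ orthocompl V (fun z => f z - p z).
Proof.
move=> VL [p0 Vp0] Vlin Vclosed Lf.
pose S := [set sqnorm (fun z => f z - p z) | p in V].
have S0 : has_inf S.
  split; first by exists (sqnorm (fun z => f z - p0 z)), p0.
  by exists 0 => _ [p _ <-]; exact: sqnorm_ge0.
have minS p : V p -> inf S <= sqnorm (fun z => f z - p z).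
  by move=> Vp; apply: ge_inf; [exact: S0.2|exists p].
(* With excess below [4^-(n+1)], the parallelogram law bounds the squared distance from [u m] to
   [u n] by four such excesses, that is by [4^-n]. *)
have /choice[u Hu] : forall n : nat, exists p,
    V p /\ sqnorm (fun z => f z - p z) < inf S + (4 ^+ n.+1)^-1.
  move=> n; have e0 : 0 < (4 ^+ n.+1)^-1 :> R by rewrite invr_gt0 exprn_gt0.
  by have [_ [p Vp <-] lt_p] := inf_adherent e0 S0; exists p.
have Vu n := (Hu n).1; have Lu n := VL _ (Vu n).
have lt4 n m : (n <= m)%N -> (4 ^+ m)^-1 <= (4 ^+ n)^-1 :> R.
  by move=> nm; rewrite lef_pV2 ?posrE ?exprn_gt0// ler_eXn2l// ltr1n.
have cauchy_u n m : (n <= m)%N -> sqnorm (fun z => u m z - u n z) <= (4 ^+ n)^-1.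
  move=> nm; have := parallelogram Lf (Lu m) (Lu n).
  have := minS _ (Vlin 2^-1 2^-1 _ _ (Vu m) (Vu n)).
  have := (Hu n).2; have := (Hu m).2; have := lt4 n.+1 m.+1 nm.
  have -> : (4 ^+ n)^-1 = 4 * (4 ^+ n.+1)^-1 :> R by rewrite exprS invfM mulrA divff// mul1r.
  move: (sqnorm _) (sqnorm _) (sqnorm _) (sqnorm _) => A B C D.
  move: (_^-1) (_^-1) => e1 e2; lra.
have [p Lp pu] := L2_cauchy_cvg Lu cauchy_u.
have Vp : V p by exact: Vclosed pu.
exists p; split=> //; split=> [|h Vh]; first exact: L2B.
have Lh := VL _ Vh; have Lfp := L2B Lf Lp.
rewrite (inner_conj Lfp Lh) -[RHS](rmorph0 (@conjc R)); congr conjc.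
apply: normsq_eq0; apply: le_anti; rewrite normsq_ge0 andbT.
have N0 : 0 <= 1 + sqnorm h by rewrite addr_ge0 ?sqnorm_ge0.
(* The constant 6 is 2 + 4: [normsqD_le] doubles the bound [4^-n] for [f - u n] and the bound
   [2 * 4^-n] for [p - u n]. *)
apply: (@le_pow4_eq0 _ (6 * (1 + sqnorm h))); first by rewrite mulr_ge0.
move=> n; have Lfu := L2B Lf (Lu n); have Lpu := L2B Lp (Lu n).
have -> : inner (fun z => f z - p z) h =
    inner (fun z => f z - u n z) h + - inner (fun z => p z - u n z) h.
  by rewrite -innerB//; apply: eq_cintegral => z; congr (_ * _); ring.
(* Every [u n + c h] lies in [V], so the almost minimal [f - u n] is almost orthogonal to [h]; this
   passes to the limit [p]. *)
have le1 : normsq (inner (fun z => f z - u n z) h) <=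
    (1 + sqnorm h) * (sqnorm (fun z => f z - u n z) - inf S).
  apply: inner_le_of_minimal => // c; have := minS _ (Vlin 1 c _ _ (Vu n) Vh).
  by under [in X in _ <= X -> _]eq_fun do rewrite mul1r opprD addrA.
have le2 := cauchy_schwarz Lpu Lh.
apply: (le_trans (normsqD_le _ _)).
have -> : normsq (- inner (fun z => p z - u n z) h) =
  normsq (inner (fun z => p z - u n z) h) by rewrite /normsq ReN ImN !sqrrN.
have hu : sqnorm (fun z => f z - u n z) - inf S <= (4 ^+ n)^-1.
  by rewrite lerBlDl (le_trans (ltW (Hu n).2))// lerD2l lt4.
have {}le1 := le_trans le1 (ler_wpM2l N0 hu).
have {}le2 := le_trans le2 (ler_wpM2l N0 (pu n)).
lra.
Qed.

End circle_hilbert.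

(** * Fourier coefficients *)

Section circle_monomials.
Context {R : realType}.
Local Notation mu := (circle_measure R).
Implicit Types (f g h : circle R -> R[i]) (c : R[i]) (z : circle R) (n m : int).

Lemma normsq_val z : normsq (val z) = 1.
Proof.
rewrite -cabs_sqr /cabs; have /eqP -> := valP z.
by rewrite /= expr1n.
Qed.

Lemma val_conj z : val z * (val z)^*%C = 1.
Proof. by rewrite mulc_conj normsq_val. Qed.

Lemma val_neq0 z : val z != 0.
Proof.
apply/eqP => z0; have := val_conj z; rewrite z0 mul0r => /eqP.
by rewrite eq_sym oner_eq0.
Qed.

Lemma valV z : (val z)^-1 = (val z)^*%C.
Proof.
by apply: (mulfI (val_neq0 z)); rewrite val_conj divff// val_neq0.
Qed.

Lemma val_expN z n : val z ^ (- n) = (val z ^ n)^*%C.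
Proof.
have conjX (x : R[i]) k : (x ^+ k)^*%C = x^*%C ^+ k.
  by elim: k => [|k IH]; rewrite ?expr0 ?conjc1// !exprS conjcM IH.
case: n => k; first by rewrite -exprz_inv valV -exprnP conjX.
by rewrite NegzE opprK -exprz_inv valV -exprnP conjX conj_conj.
Qed.

Lemma val_expD z n m : val z ^ (n + m) = val z ^ n * val z ^ m.
Proof. by rewrite expfzDr// val_neq0. Qed.

Lemma normsq_exp z n : normsq (val z ^ n) = 1.
Proof.
apply: complexI; rewrite -mulc_conj -val_expN -val_expD subrr expr0z.
by [].
Qed.

Lemma cmeasurable_exp n : cmeasurable (fun z : circle R => val z ^ n).
Proof.
have mX k : cmeasurable (fun z : circle R => val z ^+ k).
  elim: k => [|k IH]; first exact: cmeasurable_cst.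
  by under eq_fun do rewrite exprS; apply: cmeasurableM => //; exact: cmeasurable_val.
case: n => k; first exact: mX.
under eq_fun do rewrite NegzE val_expN.
exact/cmeasurable_conj/mX.
Qed.

Lemma L2_mul_exp f n : L2 f -> L2 (fun z => f z * val z ^ n).
Proof.
move=> /L2P[mf If]; apply/L2P; split.
  by apply: cmeasurableM => //; exact: cmeasurable_exp.
by apply: eq_integrable If => // z _ /=; rewrite normsqM normsq_exp mulr1.
Qed.

Lemma L2_exp n : L2 (fun z : circle R => val z ^ n).
Proof.
have := L2_mul_exp n (L2_cst (1 : R[i])).
by under eq_fun do rewrite mul1r.
Qed.

Lemma fourier_inner f n : fourier f n = inner f (fun z => val z ^ n).
Proof. by apply: eq_cintegral => z; rewrite val_expN. Qed.

Lemma inner_exp f n : L2 f -> inner (fun z => val z ^ n) f = (fourier f n)^*%C.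
Proof.
by move=> Lf; rewrite fourier_inner (inner_conj Lf (L2_exp n)).
Qed.

Lemma fourier_linear a b f g n : L2 f -> L2 g ->
  fourier (fun z => a * f z + b * g z) n = a * fourier f n + b * fourier g n.
Proof.
by move=> Lf Lg; rewrite !fourier_inner inner_linear//; exact: L2_exp.
Qed.

Lemma fourierB f g n : L2 f -> L2 g ->
  fourier (fun z => f z - g z) n = fourier f n - fourier g n.
Proof. by move=> Lf Lg; rewrite !fourier_inner innerB//; exact: L2_exp. Qed.

Lemma fourierD f g n : L2 f -> L2 g ->
  fourier (fun z => f z + g z) n = fourier f n + fourier g n.
Proof.
move=> Lf Lg; have := fourier_linear 1 1 n Lf Lg; rewrite !mul1r => <-.
by apply: eq_cintegral => z; rewrite !mul1r.
Qed.

Lemma fourier_mul_exp f n m : fourier (fun z => f z * val z ^ m) n = fourier f (n - m).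
Proof.
by apply: eq_cintegral => z; rewrite -mulrA -val_expD opprB.
Qed.

Lemma fourier_conj f n : L2 f ->
  fourier (fun z => (f z)^*%C) n = (fourier f (- n))^*%C.
Proof.
move=> Lf; rewrite /fourier opprK -cintegral_conj.
  by apply: eq_cintegral => z; rewrite conjcM -val_expN.
by apply: cintegrableM => //; exact: L2_exp.
Qed.

Lemma ae_eq_fourier f g n : L2 f -> L2 g -> f = g %[ae mu] ->
  fourier f n = fourier g n.
Proof.
move=> Lf Lg fg; apply: ae_eq_cintegral.
- exact: L2_cmeasurable (L2_mul_exp _ Lf).
- exact: L2_cmeasurable (L2_mul_exp _ Lg).
- by apply: filterS fg => z /(_ I) ->.
Qed.

(** Transport along [expi] to the interval from 0 to 1, then the fundamental theorem of calculus.
    The transport lemma [ge0_integral_distribution] wants a nonnegative integrand, hence the passage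
    from [G] to [1 + G]. *)
Lemma Rintegral_circle (G : circle R -> R) (F : R -> R) :
  measurable_fun [set: circle R] G -> (forall z, `|G z| <= 1) ->
  continuous (fun t : R => G (expi (t : measurableTypeR R))) ->
  (forall t : R, is_derive t (1 : R) F (G (expi (t : measurableTypeR R)))) ->
  \int[mu]_z G z = F 1 - F 0.
Proof.
move=> mG G1 cG dF.
have I1 : mu.-integrable [set: circle R] (EFin \o (fun=> 1 : R)).
  exact: finite_measure_integrable_cst.
have IG : mu.-integrable [set: circle R] (EFin \o G).
  apply: (le_integrable measurableT _ _ I1).
    exact/measurable_EFinP.
  by move=> z _ /=; rewrite lee_fin normr1.
have G1_ge0 z : (0 <= (1 + G z)%:E)%E.
  by rewrite lee_fin -lerBlDl sub0r; move: (G1 z); rewrite ler_norml => /andP[].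
apply: (@addrI _ 1); have -> : 1 + \int[mu]_z G z = \int[mu]_z (1 + G z).
  rewrite (RintegralD measurableT I1 IG) Rintegral_cst// mul1r; congr (_ + _).
  by rewrite -[LHS]/(fine (1%:E : \bar R)) -(@probability_setT _ _ _ mu).
have mG1 : measurable_fun [set: circle R] (EFin \o (fun z => 1 + G z)).
  by apply/measurable_EFinP; exact: measurable_funD.
rewrite /Rintegral ge0_integral_distribution//.
rewrite integral_uniform; [|exact: (measurableT_comp mG1 (@measurable_expi R))|by move=> t; exact: G1_ge0].
have dF1 (t : R) : is_derive t (1 : R) (fun t => t + F t) (1 + G (expi (t : measurableTypeR R))).
  by have := dF t => ?; apply: is_derive_eq.
have cF : continuous (fun t => t + F t).
  move=> t; apply: differentiable_continuous; apply/derivable1_diffP.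
  exact: ex_derive.
rewrite subr0 invr1 mul1e (@continuous_FTC2 _ _ (fun t => t + F t)) //.
- by rewrite /= add0r addrA.
- apply: continuous_subspaceT => t.
  by apply: cvgD; [exact: cvg_cst|exact: cG].
- by split=> [t _||]; [exact: ex_derive|apply: cvg_at_right_filter; exact: cF|apply: cvg_at_left_filter; exact: cF].
by move=> t _; rewrite derive1E derive_val.
Qed.

Lemma val_expi_exp (t : measurableTypeR R) k :
  val (expi t) ^+ k = (cos (2 * pi * (k%:R * t)) +i* sin (2 * pi * (k%:R * t)))%C.
Proof.
elim: k => [|k IH]; first by rewrite expr0 mul0r mulr0 cos0 sin0.
have -> : 2 * pi * (k.+1%:R * t) = 2 * pi * t + 2 * pi * (k%:R * t) :> R.
  by rewrite -natr1; ring.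
by rewrite exprS IH cosD sinD; apply: complex_inj => /=; ring.
Qed.

Lemma normr_ReIm_exp z n :
  `|complex.Re (val z ^ n)| <= 1 /\ `|complex.Im (val z ^ n)| <= 1.
Proof.
have := normsq_exp z n; rewrite /normsq => e.
by split; rewrite -(@ler_pXn2r _ 2)// ?nnegrE// expr1n real_normK ?num_real// -e
  ?lerDl ?lerDr sqr_ge0.
Qed.

Lemma cintegrable_exp n : cintegrable (fun z : circle R => val z ^ n).
Proof.
have := cintegrableM (L2_exp n) (L2_cst (1 : R[i])).
by under eq_fun do rewrite mulr1.
Qed.

Lemma cintegral_exp n : n != 0 -> cintegral (fun z : circle R => val z ^ n) = 0.
Proof.
have pos k : cintegral (fun z : circle R => val z ^ k.+1%:Z) = 0.
  have w0 : 2 * pi * k.+1%:R != 0 :> R by rewrite !mulf_neq0// ?pnatr_eq0// gt_eqF// pi_gt0.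
  have [mr mi] := cmeasurable_exp k.+1%:Z.
  have E (t : measurableTypeR R) : val (expi t) ^ k.+1%:Z =
      (cos (2 * pi * k.+1%:R * (t : R)) +i* sin (2 * pi * k.+1%:R * (t : R)))%C.
    by rewrite -exprnP val_expi_exp !mulrA.
  set w := 2 * pi * _ in w0 E.
  have dlin (t : R) : is_derive t (1 : R) (fun t => w * t) w.
    by apply: is_derive_eq; rewrite [_ *: _]mulr1.
  have clin : continuous (fun t : R => w * t) by exact: mulrl_continuous.
  have wE : w = 0 + pi *+ 2 *+ k.+1.
    by rewrite add0r -[RHS]mulr_natr -[pi *+ 2]mulr_natl.
  have sin_w : sin w = 0 by rewrite wE (periodicn (@sinD2pi R)) sin0.
  have cos_w : cos w = 1 by rewrite wE (periodicn (@cosD2pi R)) cos0.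
  have re_abs1 z : `|complex.Re (val z ^ k.+1%:Z)| <= 1 by exact: (normr_ReIm_exp _ _).1.
  have im_abs1 z : `|complex.Im (val z ^ k.+1%:Z)| <= 1 by exact: (normr_ReIm_exp _ _).2.
  apply: complex_inj => /=.
    apply: (etrans (Rintegral_circle (F := fun t => w^-1 * sin (w * t)) mr re_abs1 _ _)).
    - under eq_fun do rewrite E /=.
      by move=> t; apply: continuous_comp; [exact: clin|exact: continuous_cos].
    - move=> t; rewrite E /=; apply: is_derive_eq.
      by rewrite [_ *: _]mulrCA mulVf// mulr1.
    - by rewrite mulr1 mulr0 sin_w sin0 subrr.
  apply: (etrans (Rintegral_circle (F := fun t => - w^-1 * cos (w * t)) mi im_abs1 _ _)).
  - under eq_fun do rewrite E /=.
    by move=> t; apply: continuous_comp; [exact: clin|exact: continuous_sin].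
  - move=> t; rewrite E /=; apply: is_derive_eq.
    by rewrite [_ *: _]mulrCA !mulNr mulVf// mulrN1 opprK.
  - by rewrite mulr1 mulr0 cos_w cos0 subrr.
case: n => [[|k]|k] n0; [by rewrite eqxx in n0|exact: pos|].
rewrite NegzE.
under [X in cintegral X]eq_fun do rewrite val_expN.
rewrite cintegral_conj ?pos ?conjc0//; exact: cintegrable_exp.
Qed.

Lemma fourier_cst c n : fourier (fun=> c : R[i]) n = if n == 0 then c else 0.
Proof.
rewrite /fourier cintegralZ; last exact: cintegrable_exp.
case: ifPn => [/eqP ->|n0]; last by rewrite cintegral_exp ?mulr0// oppr_eq0.
rewrite oppr0; under [X in cintegral X]eq_fun do rewrite expr0z.
rewrite (_ : cintegral _ = 1) ?mulr1//; apply: complex_inj => /=.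
  rewrite Rintegral_cst// mul1r.
  by rewrite -[RHS]/(fine (1%:E : \bar R)) -(@probability_setT _ _ _ mu).
by rewrite Rintegral_cst// mul0r.
Qed.

Lemma fourier_exp n m : fourier (fun z : circle R => val z ^ m) n = (n == m)%:R.
Proof.
have := fourier_mul_exp (fun=> 1 : R[i]) n m.
under [X in fourier X]eq_fun do rewrite mul1r.
by move=> ->; rewrite fourier_cst subr_eq0; case: ifP.
Qed.

End circle_monomials.

(** * Completeness of the Fourier system *)

Section threshold.
Context {R : realType}.
Implicit Types (t y s : R) (N n : nat).

Lemma bernoulli_sub t N : 0 <= t <= 1 -> 1 - N%:R * t <= (1 - t) ^+ N.
Proof.
move=> /andP[t0 t1]; elim: N => [|N IH]; first by rewrite mul0r subr0.
have u0 : 0 <= 1 - t by rewrite subr_ge0.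
rewrite exprS; apply: le_trans (ler_wpM2l u0 IH); rewrite -subr_ge0 -natr1.
by rewrite (_ : _ - _ = N%:R * t ^+ 2) ?mulr_ge0 ?sqr_ge0//; ring.
Qed.

(** The upper counterpart [(1 - t)^N <= 1 / (1 + N t)] of Bernoulli's inequality, cleared of its
    denominator. *)
Lemma expr1B_mul_le1 t N : 0 <= t <= 1 -> (1 - t) ^+ N * (1 + N%:R * t) <= 1.
Proof.
move=> /andP[t0 t1]; have u0 : 0 <= 1 - t by rewrite subr_ge0.
elim: N => [|N IH]; first by rewrite mul0r addr0 mulr1.
apply: le_trans IH; rewrite exprSr -mulrA ler_wpM2l ?exprn_ge0// -subr_ge0 -natr1.
by rewrite (_ : _ - _ = (N%:R + 1) * t ^+ 2) ?mulr_ge0 ?sqr_ge0//; ring.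
Qed.

(* The factor [n] in the exponent makes the limit at [y = 1/2] equal to [0]. *)
Definition threshold n y : R := (1 - y ^+ (2 * n)) ^+ (n * 4 ^ n).

Lemma threshold_itv n y : 0 <= y <= 1 -> 0 <= threshold n y <= 1.
Proof.
move=> /andP[y0 y1]; rewrite /threshold.
have u0 : 0 <= 1 - y ^+ (2 * n) by rewrite subr_ge0 exprn_ile1.
by rewrite exprn_ge0//= exprn_ile1// gerBl exprn_ge0.
Qed.

(** With [t = y^(2n)] and [N = n 4^n], the product [N t] is [n (2y)^(2n)]. It tends to 0 when
    [2y < 1], where the lower bound [1 - N t] applies, and is at least [n] otherwise, where the
    upper bound gives at most [1 / (n + 1)]. *)
Lemma cvg_threshold y : 0 <= y <= 1 ->
  threshold n y @[n --> \oo] --> (if y < 2^-1 then 1 else 0 : R).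
Proof.
move=> /andP[y0 y1].
have E n : (n * 4 ^ n)%:R * y ^+ (2 * n) = n%:R * ((2 * y) ^+ n) ^+ 2 :> R.
  rewrite natrM natrX -mulrA; congr (_ * _).
  have -> : 4%:R = 2 ^+ 2 :> R by rewrite -natrX.
  by rewrite -!exprM [(n * 2)%N]mulnC exprMn.
have t01 n : 0 <= y ^+ (2 * n) <= 1 by rewrite exprn_ge0// exprn_ile1.
have [y2|y2] := ltP y 2^-1.
  pose s := 2 * y; have s0 : 0 <= s by rewrite mulr_ge0.
  have s1 : s < 1 by rewrite /s mulrC -ltr_pdivlMr// mul1r.
  apply: (@squeeze_cvgr _ _ _ _ (fun n => 1 - (1 - s)^-1 * s ^+ n) (fun=> 1)).
  - apply: nearW => n; have /andP[_ ->] := threshold_itv n (introT andP (conj y0 y1)).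
    rewrite andbT; apply: le_trans (bernoulli_sub _ (t01 n)).
    (* One of the two factors [s^n] absorbs [n]: from [s^n (1 + n (1 - s)) <= 1] one gets
       [n s^n <= 1 / (1 - s)]. The other leaves a geometric sequence. *)
    rewrite E lerD2l lerN2 -/s expr2 mulrA ler_wpM2r ?exprn_ge0//.
    rewrite -[leRHS]mul1r ler_pdivlMr ?subr_gt0//.
    have := @expr1B_mul_le1 (1 - s) n; rewrite subKr subr_ge0 gerBl s0 (ltW s1) => /(_ isT).
    apply: le_trans; rewrite -subr_ge0 (_ : _ - _ = s ^+ n) ?exprn_ge0//.
    by ring.
  - rewrite -[X in _ --> X]subr0; apply: cvgB; first exact: cvg_cst.
    by apply: cvg_geometric; rewrite ger0_norm.
  - exact: cvg_cst.
apply: (@squeeze_cvgr _ _ _ _ (fun=> 0) (@harmonic R)); last 2 first.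
- exact: cvg_cst.
- exact: cvg_harmonic.
apply: nearW => n; have /andP[-> _] := threshold_itv n (introT andP (conj y0 y1)).
rewrite /= -[leRHS]mul1r ler_pdivlMr ?ltr0n//.
apply: le_trans (expr1B_mul_le1 (n * 4 ^ n) (t01 n)).
rewrite ler_wpM2l ?exprn_ge0 ?subr_ge0 ?(andP (t01 n)).2//.
rewrite -natr1 addrC lerD2l E ler_peMr// expr_ge1 ?mulr_ge0//.
  by rewrite exprn_ege1// mulrC -ler_pdivrMr// mul1r.
by rewrite exprn_ge0// mulr_ge0.
Qed.

End threshold.

(** * Functions whose Fourier coefficients all vanish *)

Section fourier_uniqueness.
Context {R : realType}.
Local Notation mu := (circle_measure R).
Implicit Types (f : circle R -> R[i]) (g h : circle R -> R) (n : int).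

(** Indices of both signs are included, so that multiplication by [z] or its inverse merely shifts
    [n]. Integrability alone is stable under bounded multipliers. *)
Definition fourier_null h :=
  mu.-integrable [set: circle R] (EFin \o h) /\
  forall n, cintegral (fun z => (h z)%:C%C * val z ^ n) = 0.

(* The multipliers of [fourier_null] form an algebra that contains the
   trigonometric polynomials and is closed under bounded pointwise limits,
   hence contains all the indicators of Borel sets. *)
Definition multiplier g := forall h, fourier_null h -> fourier_null (fun z => g z * h z).

Lemma cintegrable_real_exp h n : mu.-integrable [set: circle R] (EFin \o h) ->
  cintegrable (fun z => (h z)%:C%C * val z ^ n).
Proof.
move=> Ih; have mh : measurable_fun [set: circle R] h.
  exact/measurable_EFinP/(measurable_int _ Ih).
have [mr mi] := cmeasurable_exp (R := R) n.
split; apply: (le_integrable measurableT _ _ Ih).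
- under eq_fun do rewrite /= ReM /= mul0r subr0.
  by apply/measurable_EFinP; exact: measurable_funM.
- move=> z _ /=; rewrite lee_fin ReM /= mul0r subr0 normrM ler_piMr//.
  exact: (normr_ReIm_exp _ _).1.
- under eq_fun do rewrite /= ImM /= mul0r addr0.
  by apply/measurable_EFinP; exact: measurable_funM.
- move=> z _ /=; rewrite lee_fin ImM /= mul0r addr0 normrM ler_piMr//.
  exact: (normr_ReIm_exp _ _).2.
Qed.

Lemma multiplier_cst (c : R) : multiplier (fun=> c).
Proof.
move=> h [Ih h0]; split; first exact: (integrableZl measurableT c Ih).
move=> n; rewrite -[RHS](mulr0 c%:C%C) -(h0 n) -cintegralZ.
  by apply: eq_cintegral => z; rewrite rmorphM/= mulrA.
exact: cintegrable_real_exp.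
Qed.

Lemma multiplierM g1 g2 : multiplier g1 -> multiplier g2 ->
  multiplier (fun z => g1 z * g2 z).
Proof.
move=> m1 m2 h h0; have := m1 _ (m2 _ h0).
by under eq_fun do rewrite mulrA.
Qed.

Lemma multiplierD g1 g2 : multiplier g1 -> multiplier g2 ->
  multiplier (fun z => g1 z + g2 z).
Proof.
move=> m1 m2 h h0; have [I1 h1] := m1 _ h0; have [I2 h2] := m2 _ h0; split.
  apply: eq_integrable (integrableD measurableT I1 I2) => // z _ /=.
  by rewrite mulrDl.
move=> n; rewrite -[RHS]addr0 -{1}(h1 n) -(h2 n) -cintegralD.
- by apply: eq_cintegral => z; rewrite mulrDl rmorphD/= mulrDl.
- exact: cintegrable_real_exp.
- exact: cintegrable_real_exp.
Qed.

Lemma multiplierX g k : multiplier g -> multiplier (fun z => g z ^+ k).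
Proof.
move=> mg; elim: k => [|k IH]; first exact: multiplier_cst.
by under eq_fun do rewrite exprS; exact: multiplierM.
Qed.

Lemma multiplier_1B g : multiplier g -> multiplier (fun z => 1 - g z).
Proof.
move=> mg; have := multiplierD (multiplier_cst 1) (multiplierM (multiplier_cst (-1)) mg).
by under eq_fun do rewrite mulN1r.
Qed.

(** Covers Re z and Im z, which on the circle are combinations of [z] and its inverse; these only
    shift the index in [fourier_null]. *)
Lemma multiplier_exp_linear g (a b : R[i]) :
  measurable_fun [set: circle R] g -> (forall z, `|g z| <= 1) ->
  (forall z : circle R, (g z)%:C%C = a * val z ^ 1%:Z + b * val z ^ (-1)) ->
  multiplier g.
Proof.
move=> mg g1 gE h [Ih h0]; have mh := measurable_int _ Ih; split.
  apply: (le_integrable measurableT _ _ Ih).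
    apply/measurable_EFinP; apply: measurable_funM => //; exact/measurable_EFinP.
  by move=> z _ /=; rewrite lee_fin normrM ler_piMl.
move=> n; pose e k z := (h z)%:C%C * val z ^ k.
have Ie k : cintegrable (e k) by exact: cintegrable_real_exp.
rewrite (@eq_cintegral _ _ (fun z => a * e (n + 1) z + b * e (n - 1) z)).
  by rewrite cintegralD ?cintegralZ ?h0 ?mulr0 ?addr0//; exact: cintegrableZ.
by move=> z; rewrite rmorphM/= gE /e !val_expD; ring.
Qed.

Lemma multiplier_Re : multiplier (fun z => complex.Re (val z)).
Proof.
apply: (@multiplier_exp_linear _ (2^-1) (2^-1)).
- exact: cmeasurable_val.1.
- by move=> z; exact: (normr_ReIm_exp z 1%:Z).1.
- by move=> z; rewrite ReJ_add val_expN mulrDl mulrC [_ / _]mulrC.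
Qed.

Lemma multiplier_Im : multiplier (fun z => complex.Im (val z)).
Proof.
apply: (@multiplier_exp_linear _ (- ('i%C / 2)) ('i%C / 2)).
- exact: cmeasurable_val.2.
- by move=> z; exact: (normr_ReIm_exp z 1%:Z).2.
- by move=> z; rewrite ImJ_sub val_expN; rewrite expr1z; ring.
Qed.

Lemma multiplier_limit (u : nat -> circle R -> R) g :
  (forall k, multiplier (u k)) -> (forall k z, `|u k z| <= 1) ->
  (forall z, u k z @[k --> \oo] --> g z) -> multiplier g.
Proof.
move=> mu_ u1 ug h h0; have Ih := h0.1.
have mh : measurable_fun [set: circle R] h.
  exact/measurable_EFinP/(measurable_int _ Ih).
have muh k : measurable_fun [set: circle R] (fun z => u k z * h z).
  exact/measurable_EFinP/(measurable_int _ (mu_ k _ h0).1).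
have ugh z : u k z * h z @[k --> \oo] --> g z * h z.
  by apply: cvgM; [exact: ug|exact: cvg_cst].
have mgh : measurable_fun [set: circle R] (fun z => g z * h z).
  by apply: (measurable_fun_cvg muh) => z _; exact: ugh.
have g1 z : `|g z| <= 1.
  have c : `|u k z| @[k --> \oo] --> `|g z| by apply: cvg_norm; exact: ug.
  rewrite -(cvg_lim _ c)//.
  by apply: limr_le; [exact: cvgP c|exact: nearW].
(* Dominated convergence is used on real integrands, so [t] stands for the real or the imaginary
   part of [z^n]; the dominating function is [|h|]. *)
have dct (t : circle R -> R) : measurable_fun [set: circle R] t ->
    (forall z, `|t z| <= 1) ->
    (forall k, \int[mu]_z (u k z * h z * t z) = 0) ->
    \int[mu]_z (g z * h z * t z) = 0.
  move=> mt t1 int0.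
  have Iuht k : mu.-integrable [set: circle R] (EFin \o (fun z => u k z * h z * t z)).
    apply: (le_integrable measurableT _ _ Ih).
      by apply/measurable_EFinP; exact: measurable_funM.
    move=> z _ /=; rewrite lee_fin !normrM mulrAC ler_piMl//.
    by rewrite mulr_ile1.
  have [_ _ cvg_int] : [/\ mu.-integrable [set: circle R] (fun z => (g z * h z * t z)%:E),
      (\int[mu]_z `|(u k z * h z * t z)%:E - (g z * h z * t z)%:E|)%E @[k --> \oo] --> 0%E &
      (\int[mu]_z (u k z * h z * t z)%:E)%E @[k --> \oo] -->
      (\int[mu]_z (g z * h z * t z)%:E)%E].
    apply: (@dominated_convergence _ _ _ mu _ measurableT _ _ (fun z => (`|h z|)%:E)).
    - by move=> k; exact: measurable_int (Iuht k).
    - by apply/measurable_EFinP; exact: measurable_funM.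
    - apply: aeW => z _; apply: cvg_EFin; first exact: nearW.
      by apply: cvgM; [exact: ugh|exact: cvg_cst].
    - exact: integrable_norm Ih.
    - apply: aeW => z k _; rewrite abse_EFin lee_fin !normrM mulrAC ler_piMl//.
      by rewrite mulr_ile1.
  have zero k : (\int[mu]_z (u k z * h z * t z)%:E = 0)%E.
    rewrite -[LHS]fineK ?integrable_fin_num//; last exact: Iuht.
    by congr EFin; exact: int0.
  rewrite /Rintegral (_ : (\int[mu]_z _ = 0)%E)//.
  rewrite -(cvg_lim _ cvg_int)//; under eq_fun do rewrite zero.
  exact: lim_cst.
split.
  apply: (le_integrable measurableT _ _ Ih); first exact/measurable_EFinP.
  by move=> z _ /=; rewrite lee_fin normrM ler_piMl.
move=> n; have [mr mi] := cmeasurable_exp (R := R) n.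
have re1 z := (normr_ReIm_exp (R := R) z n).1.
have im1 z := (normr_ReIm_exp (R := R) z n).2.
apply: complex_inj => /=.
  under eq_Rintegral do rewrite ReM /= mul0r subr0.
  apply: dct => // k; have := congr1 (@complex.Re R) ((mu_ k _ h0).2 n).
  by rewrite /=; under eq_Rintegral do rewrite ReM /= mul0r subr0.
under eq_Rintegral do rewrite ImM /= mul0r addr0.
apply: dct => // k; have := congr1 (@complex.Im R) ((mu_ k _ h0).2 n).
by rewrite /=; under eq_Rintegral do rewrite ImM /= mul0r addr0.
Qed.

Definition mult_set (A : set (circle R)) := multiplier (\1_A : circle R -> R).

Lemma mult_setC A : mult_set A -> mult_set (~` A).
Proof.
move=> /multiplier_1B; rewrite /mult_set; congr multiplier.
apply/funext => z; rewrite !indicE in_setC.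
by case: (z \in A); rewrite ?subrr ?subr0.
Qed.

Lemma mult_setI A B : mult_set A -> mult_set B -> mult_set (A `&` B).
Proof.
move=> mA mB; have := multiplierM mA mB; rewrite /mult_set; congr multiplier.
by apply/funext => z; rewrite !indicE in_setI; case: (z \in A); rewrite ?mul1r ?mul0r.
Qed.

(** A countable union is the pointwise limit of the finite unions [A m], written through complements
    because products of indicators give intersections. *)
Lemma sigma_algebra_mult_set : sigma_algebra [set: circle R] mult_set.
Proof.
split.
- by rewrite /mult_set indic0; exact: multiplier_cst.
- by move=> A mA; rewrite setTD; exact: mult_setC.
move=> F mF; pose A m := ~` \big[setI/setT]_(i < m) ~` F i.
have mA m : mult_set (A m).
  apply: mult_setC; elim/big_ind: _ => //.
  - by rewrite /mult_set indicT; exact: multiplier_cst.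
  - exact: mult_setI.
  - by move=> i _; exact: mult_setC.
apply: (@multiplier_limit (fun m => \1_(A m))) => //.
  by move=> n z; rewrite indicE; case: (z \in A n); rewrite ?normr1 ?normr0.
move=> z; rewrite indicE.
case: (boolP (z \in \bigcup_k F k)) => [|zF].
  rewrite inE => -[k _ Fkz]; apply: cvg_near_cst; near=> n.
  rewrite indicE mem_set// => zA.
  have kn : (k < n)%N by near: n; exists k.+1.
  by move: zA; rewrite -(bigcap_mkord _ (fun i => ~` F i)) => /(_ k kn); exact.
apply: cvg_near_cst; apply: nearW => n; rewrite indicE memNset//.
apply; rewrite -(bigcap_mkord _ (fun i => ~` F i)) => k kn Fkz.
by move/negP: zF; apply; rewrite inE; exists k.
Unshelve. all: by end_near. Qed.

(** The affine image [y] of [g] satisfies [y < 1/2] exactly where [g > x]. Thresholds of [y] are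
    polynomials in [g], hence multipliers, and their limit 0 at [y = 1/2] makes the inequality
    strict. *)
Lemma mult_set_gt g (x : R) : multiplier g -> (forall z, `|g z| <= 1) ->
  mult_set [set z | x < g z].
Proof.
(* Since [|g - x| <= 1 + |x|], dividing by [D] leaves a deviation of at most 1/2, which keeps [y]
   between 0 and 1. *)
move=> mg g1; pose D := 2 * (1 + `|x|).
have D0 : 0 < D by rewrite mulr_gt0// ltr_pwDl.
pose y z := 2^-1 - (g z - x) / D.
have y01 z : 0 <= y z <= 1.
  have : `|(g z - x) / D| <= 2^-1.
    rewrite normrM normfV [`|D|]gtr0_norm// ler_pdivrMr// mulKf//.
    by rewrite (le_trans (ler_normB _ _))// lerD2r.
  rewrite ler_norml => /andP[lo hi]; rewrite /y subr_ge0 hi/=.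
  by rewrite lerBlDl -lerBlDr (_ : 2^-1 - 1 = - 2^-1)//; field.
have my : multiplier y.
  have -> : y = (fun z => (2^-1 + x / D) + - D^-1 * g z).
    by apply/funext => z; rewrite /y; field; rewrite gt_eqF.
  by apply: multiplierD; [exact: multiplier_cst|apply: multiplierM => //; exact: multiplier_cst].
apply: (@multiplier_limit (fun m z => threshold m (y z))).
- by move=> n; apply/multiplierX/multiplier_1B/multiplierX.
- by move=> n z; have /andP[t0 t1] := threshold_itv n (y01 z); rewrite ger0_norm.
move=> z; have := cvg_threshold (y01 z).
have -> : (y z < 2^-1) = (x < g z) by rewrite gtrBl pmulr_lgt0 ?invr_gt0// subr_gt0.
rewrite indicE; have [xg|xg] := ltP x (g z); first by rewrite mem_set.
by rewrite memNset//=; apply/negP; rewrite -leNgt.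
Qed.

(** Equip the circle with the sigma-algebra formed by the [mult_set]s. Re z and Im z are measurable
    for it by [mult_set_gt], hence so is [circle_ReIm], whose preimages are the Borel sets. *)
Lemma measurable_mult_set A : measurable A -> mult_set A.
Proof.
pose S := g_sigma_algebraType mult_set.
have mS (B : set S) : measurable B -> mult_set B.
  by rewrite /measurable/= sigma_algebra_id//; exact: sigma_algebra_mult_set.
have mgt (g : circle R -> R) : multiplier g -> (forall z, `|g z| <= 1) ->
    measurable_fun [set: S] (g : S -> R).
  move=> mg g1; apply: (measurability _ (RGenOInfty.measurableE R)).
  move=> _ [_ [x ->] <-]; rewrite setTI; apply: sub_sigma_algebra.
  rewrite (_ : _ @^-1` _ = [set z | x < g z]); first exact: mult_set_gt.
  by apply/seteqP; split=> z /=; rewrite in_itv/= andbT.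
have mReIm : measurable_fun [set: S] (@circle_ReIm R : S -> R * R).
  apply: measurable_fun_pair; apply: mgt.
  - exact: multiplier_Re.
  - by move=> z; exact: (normr_ReIm_exp z 1%:Z).1.
  - exact: multiplier_Im.
  - by move=> z; exact: (normr_ReIm_exp z 1%:Z).2.
move=> [B mB <-]; apply: mS; exact: mReIm.
Qed.

Lemma fourier_null_ae0 h : fourier_null h -> h = (fun=> 0) %[ae mu].
Proof.
move=> h0; have Ih := h0.1.
have : ae_eq mu [set: circle R] (EFin \o h) (cst 0%E).
  apply: integral_ae_eq => // E _ mE.
  rewrite integral0 integral_mkcond.
  (* The coefficient of index 0 of [\1_E h] is the integral of [h] over [E]. *)
  have [IE E0] := measurable_mult_set mE h0.
  have /(congr1 (@complex.Re R)) := E0 0.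
  rewrite /= (@eq_Rintegral _ _ _ _ _ (fun z => \1_E z * h z)) => [int0|z _].
    rewrite (eq_integral (EFin \o (fun z => \1_E z * h z))).
      rewrite -[LHS]fineK ?integrable_fin_num//.
      by congr EFin; exact: int0.
    move=> z _; rewrite /patch /= indicE; case: (z \in E); by rewrite ?mul1r ?mul0r.
  by rewrite mulr1 mulr0 subr0.
by apply: filterS => z /(_ I) [].
Qed.

(** The real part is half the sum of [f] and its conjugate, so its coefficients vanish too; the
    imaginary part of [f] is the real part of [- i f]. *)
Lemma fourier_eq0 f : L2 f -> (forall n, fourier f n = 0) -> f = (fun=> 0) %[ae mu].
Proof.
have real_part (g : circle R -> R[i]) : L2 g -> (forall n, fourier g n = 0) ->
    (fun z => complex.Re (g z)) = (fun=> 0) %[ae mu].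
  move=> Lg g0; apply: fourier_null_ae0.
  have Lr := L2D (L2Z 2^-1 Lg) (L2Z 2^-1 (L2_conj Lg)).
  have rE z : 2^-1 * g z + 2^-1 * (g z)^*%C = (complex.Re (g z))%:C%C.
    by rewrite ReJ_add -mulrDr mulrC.
  split.
    have := (cintegrableM Lr (L2_cst 1)).1; apply: eq_integrable => // z _ /=.
    by rewrite mulr1 rE.
  move=> n; have := fourier_linear 2^-1 2^-1 (- n) Lg (L2_conj Lg).
  rewrite fourier_conj// !g0 conjc0 !mulr0 addr0 => <-.
  by apply: eq_cintegral => z; rewrite rE opprK.
move=> Lf f0; have r0 := real_part f Lf f0.
have : (fun z => complex.Re (- 'i%C * f z)) = (fun=> 0) %[ae mu].
  apply: real_part; first exact: L2Z.
  move=> n; have := fourier_linear (- 'i%C) 0 n Lf Lf.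
  rewrite f0 !mulr0 addr0 => <-.
  by apply: eq_cintegral => z; rewrite mul0r addr0.
apply: filterS2 r0 => z /(_ I) rz /(_ I) iz _; apply: complex_inj => //.
by move: iz; rewrite ReM ReN ImN /= oppr0 mul0r mulN1r opprK add0r.
Qed.

End fourier_uniqueness.

(** * The projection on the Hardy space *)

Section hardy_projection.
Context {R : realType}.
Local Notation mu := (circle_measure R).
Implicit Types (f g p q : circle R -> R[i]) (a b c : R[i]) (n m k : int).

Lemma ae_eq_of_fourier f g : L2 f -> L2 g ->
  (forall n, fourier f n = fourier g n) -> f = g %[ae mu].
Proof.
move=> Lf Lg fg; have : (fun z => f z - g z) = (fun=> 0) %[ae mu].
  by apply: fourier_eq0 => [|n]; [exact: L2B|rewrite fourierB// fg subrr].
by apply: filterS => z /(_ I) /eqP; rewrite subr_eq0 => /eqP.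
Qed.

Lemma H2_L2 f : H2 f -> L2 f. Proof. by case. Qed.

Lemma H2_linear a b p q : H2 p -> H2 q -> H2 (fun z => a * p z + b * q z).
Proof.
move=> [Lp p0] [Lq q0]; split; first by apply: L2D; exact: L2Z.
by move=> n n0; rewrite fourier_linear// p0// q0// !mulr0 addr0.
Qed.

(** A Fourier coefficient is an inner product, hence continuous by [cauchy_schwarz]. *)
Lemma H2_closed (u : nat -> circle R -> R[i]) (w : circle R -> R[i]) :
  (forall i, H2 (u i)) -> L2 w ->
  (forall i, sqnorm (fun z => w z - u i z) <= 2 * (4 ^+ i)^-1) -> H2 w.
Proof.
move=> Hu Lw wu; split=> // n n0; apply: normsq_eq0; apply: le_anti.
rewrite normsq_ge0 andbT; set e := fun z : circle R => val z ^ n.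
have Le : L2 e by exact: L2_exp.
apply: (@le_pow4_eq0 _ _ (2 * (1 + sqnorm e))).
  by rewrite mulr_ge0// addr_ge0// sqnorm_ge0.
move=> i; have [Lui ui0] := Hu i; have Lwu := L2B Lw Lui.
have -> : fourier w n = inner (fun z => w z - u i z) e.
  by rewrite -fourier_inner fourierB// ui0// subr0.
apply: (le_trans (cauchy_schwarz Lwu Le)).
rewrite -mulrA mulrCA ler_wpM2l ?addr_ge0 ?sqnorm_ge0//.
Qed.

(** Existence of a projection excludes the default value in [orthoproj]. *)
Lemma P_spec f : L2 f -> H2 (P f) /\ orthocompl (@H2 R) (Q f).
Proof.
move=> Lf; apply: (@xgetPex _ (fun=> 0)
  [set p | H2 p /\ orthocompl (@H2 R) (fun z => f z - p z)]).
apply: ex_orthogonal_projection => //.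
- by move=> p [].
- exists (fun=> 0); split; first exact: L2_cst.
  by move=> n _; rewrite fourier_cst; case: ifP.
- by move=> a b p q; exact: H2_linear.
- exact: H2_closed.
Qed.

Lemma P_H2 f : L2 f -> H2 (P f). Proof. by move=> /P_spec[]. Qed.

Lemma P_L2 f : L2 f -> L2 (P f). Proof. by move=> /P_H2[]. Qed.

Lemma Q_L2 f : L2 f -> L2 (Q f). Proof. by move=> Lf; apply: L2B => //; exact: P_L2. Qed.

Lemma H2_exp n : 0 <= n -> H2 (fun z : circle R => val z ^ n).
Proof.
move=> n0; split=> [|m m0]; first exact: L2_exp.
by rewrite fourier_exp lt_eqF// (lt_le_trans m0).
Qed.

Lemma fourier_Q_ge0 f n : L2 f -> 0 <= n -> fourier (Q f) n = 0.
Proof.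
move=> Lf n0; have [_ [LQ /(_ _ (H2_exp n0))]] := P_spec Lf.
by rewrite inner_exp// => /eqP; rewrite conjc_eq0 => /eqP.
Qed.

Lemma fourier_P_ge0 f n : L2 f -> 0 <= n -> fourier (P f) n = fourier f n.
Proof.
move=> Lf n0; have := fourier_Q_ge0 Lf n0; rewrite fourierB//; last exact: P_L2.
by move=> /eqP; rewrite subr_eq0 => /eqP.
Qed.

(** Turns the choice behind [P] into truncation of the Fourier series; the identities for [P] below
    are obtained through it. *)
Lemma P_unique f p : L2 f -> L2 p ->
  (forall n, 0 <= n -> fourier p n = fourier f n) ->
  (forall n, n < 0 -> fourier p n = 0) -> P f = p %[ae mu].
Proof.
move=> Lf Lp pge plt; apply: ae_eq_of_fourier => //; first exact: P_L2.
move=> n; have [n0|n0] := leP 0 n; first by rewrite fourier_P_ge0// pge.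
by rewrite plt//; exact: (P_H2 Lf).2.
Qed.

Lemma P_ae_eq f g : L2 f -> L2 g -> f = g %[ae mu] -> P f = P g %[ae mu].
Proof.
move=> Lf Lg fg; apply: P_unique => //; first exact: P_L2.
  by move=> n n0; rewrite fourier_P_ge0//; apply/esym/ae_eq_fourier.
by move=> n n0; exact: (P_H2 Lg).2.
Qed.

Lemma P_linear a b f g : L2 f -> L2 g ->
  P (fun z => a * f z + b * g z) = (fun z => a * P f z + b * P g z) %[ae mu].
Proof.
move=> Lf Lg; have Pf := P_H2 Lf; have Pg := P_H2 Lg; apply: P_unique.
- by apply: L2D; exact: L2Z.
- by apply: L2D; apply: L2Z; exact: P_L2.
- by move=> n n0; rewrite !fourier_linear ?fourier_P_ge0//; exact: P_L2.
- exact: (H2_linear _ _ Pf Pg).2.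
Qed.

Lemma P_id p : H2 p -> P p = p %[ae mu].
Proof. by move=> [Lp p0]; exact: P_unique. Qed.

Lemma P_eq0 g : L2 g -> (forall n, 0 <= n -> fourier g n = 0) ->
  P g = (fun=> 0) %[ae mu].
Proof.
move=> Lg g0; apply: P_unique => //; first exact: L2_cst.
  by move=> n n0; rewrite g0// fourier_cst; case: ifP.
by move=> n n0; rewrite fourier_cst; case: ifP.
Qed.

(** A substitute for Parseval: [P g] vanishes, so [g] agrees almost everywhere with [Q g], which is
    orthogonal to H2. *)
Lemma inner_H2_eq0 p g : H2 p -> L2 g -> (forall n, 0 <= n -> fourier g n = 0) ->
  inner p g = 0.
Proof.
move=> Hp Lg g0; have [_ [LQ /(_ _ Hp) <-]] := P_spec Lg.
apply: ae_eq_cintegral.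
- by apply: cmeasurableM; [case: Hp.1|case: (L2_conj Lg)].
- by apply: cmeasurableM; [case: Hp.1|case: (L2_conj LQ)].
by apply: filterS (P_eq0 Lg g0) => z /(_ I) Pz _; rewrite /Q Pz subr0.
Qed.

(** No convolution of coefficients: [alpha] moves to the other side of the inner product. For
    [n < 0] the conjugate of [alpha] times [z^n] has no coefficient of index [k >= 0], as [n - k] is
    negative. *)
Lemma analytic_mul alpha p : Linfty alpha -> analytic alpha -> H2 p ->
  H2 (fun z => alpha z * p z).
Proof.
move=> La [_ a0] Hp; split; first by apply: L2M_Linfty => //; exact: H2_L2.
move=> n n0; pose g z : R[i] := (alpha z)^*%C * val z ^ n.
have Lca := L2_conj (Linfty_L2 La).
rewrite (_ : fourier _ n = inner p g).
  apply: inner_H2_eq0 => // [|k k0]; first exact: L2_mul_exp.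
  rewrite fourier_mul_exp fourier_conj ?a0 ?conjc0//; last exact: Linfty_L2.
  by rewrite opprB subr_lt0 (lt_le_trans n0).
by apply: eq_cintegral => z; rewrite /g conjcM conj_conj val_expN mulrCA mulrA.
Qed.

(** Dually, for [n >= 0] the conjugate of [beta] times [z^n] lies in H2, to which [Q f] is
    orthogonal. *)
Lemma fourier_coanalytic_mul beta f n : Linfty beta -> coanalytic beta -> L2 f ->
  0 <= n -> fourier (fun z => beta z * Q f z) n = 0.
Proof.
move=> Lb cb Lf n0; have [Lcb b0] := cb.
have Hg : H2 (fun z => (beta z)^*%C * val z ^ n).
  split=> [|k k0]; first exact: L2_mul_exp.
  by rewrite fourier_mul_exp b0// subr_lt0 (lt_le_trans k0).
have [_ [LQ /(_ _ Hg) /(congr1 (@conjc R))]] := P_spec Lf.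
rewrite conjc0 -inner_conj//; last exact: H2_L2.
move=> <-; apply: eq_cintegral => z.
by rewrite conjcM conj_conj val_expN mulrCA mulrA.
Qed.

(** Multiplication by [z] carries exactly one coefficient, that of index -1, across the boundary
    between the two subspaces. *)
Lemma P_mul_val g : L2 g ->
  P (fun z => g z * val z ^ 1) = (fun z => val z * P g z + fourier g (-1)) %[ae mu].
Proof.
move=> Lg; have LP := P_L2 Lg; set c := fourier g (-1).
suff : P (fun z => g z * val z ^ 1) = (fun z => P g z * val z ^ 1 + c) %[ae mu].
  by apply: filterS => z /(_ I) -> _; rewrite expr1z mulrC.
have LPz := L2_mul_exp 1 LP; have Lc := L2_cst c.
have fE n : fourier (fun z => P g z * val z ^ 1 + c) n =
    fourier (P g) (n - 1) + if n == 0 then c else 0.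
  by rewrite fourierD// fourier_mul_exp fourier_cst.
apply: P_unique; [exact: L2_mul_exp|exact: L2D| |] => n n0; rewrite fE ?fourier_mul_exp.
  (* At index 0 the term [z P g] contributes nothing, and the constant supplies the whole
     coefficient. *)
  case: eqVneq => [->|nn0]; first by rewrite sub0r (P_H2 Lg).2// add0r.
  by rewrite addr0 fourier_P_ge0// subr_ge0 -gtz0_ge1 lt_neqAle eq_sym nn0.
rewrite (P_H2 Lg).2 ?lt_eqF ?addr0//.
by rewrite (lt_trans _ n0)// gtrBl.
Qed.

End hardy_projection.

(** * Commuting singular operators *)

(* Otherwise unification tries to unfold the projections that it compares. *)
Opaque P fourier.

Section commutation.
Context {R : realType}.
Local Notation mu := (circle_measure R).
Implicit Types (alpha beta f g p q : circle R -> R[i]) (a b c : R[i]) (n m k : int).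

Lemma QE f (z : circle R) : Q f z = f z - P f z. Proof. by []. Qed.

Definition defect alpha beta f : circle R -> R[i] :=
  fun z => P (fun z => beta z * Q f z) z - Q (fun z => alpha z * P f z) z.

(** With [E] the defect of the inner operator, its value at [f] has projections [alpha2 p + E] and
    [beta2 q - E], where [p = P f] and [q = Q f]. *)
Lemma singular_op_comp alpha1 beta1 alpha2 beta2 f :
  Linfty alpha2 -> Linfty beta2 -> L2 f ->
  singular_op alpha1 beta1 (singular_op alpha2 beta2 f) =
  (fun z => alpha1 z * alpha2 z * P f z + beta1 z * beta2 z * Q f z +
     (alpha1 z - beta1 z) * defect alpha2 beta2 f z) %[ae mu].
Proof.
move=> La Lb Lf; have Lap := L2M_Linfty La (P_L2 Lf).
have Lbq := L2M_Linfty Lb (Q_L2 Lf).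
have := P_linear 1 1 Lap Lbq.
rewrite (_ : (fun z => 1 * _ + 1 * _) = singular_op alpha2 beta2 f); last first.
  by apply/funext => z; rewrite !mul1r.
have alg (al be u v p q A B : R[i]) : al * (A + B) + be * (u * p + v * q - (A + B)) =
    al * u * p + be * v * q + (al - be) * (B - (u * p - A)) by ring.
apply: filterS => z /(_ I); rewrite !mul1r => PS _.
rewrite {1}/singular_op [Q (singular_op _ _ _) z]QE PS /defect.
rewrite [Q (fun z => alpha2 z * _) z]QE; exact: alg.
Qed.

Lemma commute_defect alpha1 beta1 alpha2 beta2 :
  Linfty alpha1 -> Linfty beta1 -> Linfty alpha2 -> Linfty beta2 ->
  commute_on_L2 (singular_op alpha1 beta1) (singular_op alpha2 beta2) <->
  forall f, L2 f ->
    (fun z => (alpha1 z - beta1 z) * defect alpha2 beta2 f z) =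
    (fun z => (alpha2 z - beta2 z) * defect alpha1 beta1 f z) %[ae mu].
Proof.
move=> La1 Lb1 La2 Lb2; split=> H f Lf; have := H f Lf;
  have S12 := singular_op_comp alpha1 beta1 La2 Lb2 Lf;
  have S21 := singular_op_comp alpha2 beta2 La1 Lb1 Lf.
  apply: filterS3 S12 S21 => z /(_ I) S12 /(_ I) S21 /(_ I) e _.
  move: e; rewrite S12 S21 [alpha2 z * _]mulrC [beta2 z * _]mulrC.
  exact: addrI.
apply: filterS3 S12 S21 => z /(_ I) S12 /(_ I) S21 /(_ I) e _.
by rewrite S12 S21 e [alpha2 z * _]mulrC [beta2 z * _]mulrC.
Qed.

Lemma defect_analytic alpha beta f : Linfty alpha -> Linfty beta ->
  analytic alpha -> coanalytic beta -> L2 f ->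
  defect alpha beta f = (fun=> 0) %[ae mu].
Proof.
move=> La Lb aa cb Lf.
have := P_id (analytic_mul La aa (P_H2 Lf)).
have := P_eq0 (L2M_Linfty Lb (Q_L2 Lf)) (fun n => fourier_coanalytic_mul Lb cb Lf).
by apply: filterS2 => z /(_ I) Pb /(_ I) Pa _; rewrite /defect /Q Pb Pa subrr subr0.
Qed.

(** The combination is the defect of the operator with both symbols equal to [c]. That operator is a
    scalar, and scalars preserve both subspaces. *)
Lemma defect_linear alpha1 beta1 alpha2 beta2 a b c f :
  Linfty alpha1 -> Linfty beta1 -> Linfty alpha2 -> Linfty beta2 -> L2 f ->
  (fun z => a * alpha1 z + b * alpha2 z) = (fun=> c) %[ae mu] ->
  (fun z => a * beta1 z + b * beta2 z) = (fun=> c) %[ae mu] ->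
  (fun z => a * defect alpha1 beta1 f z + b * defect alpha2 beta2 f z) =
    (fun=> 0) %[ae mu].
Proof.
move=> La1 Lb1 La2 Lb2 Lf ac bc.
have LP := P_L2 Lf; have LQ := Q_L2 Lf.
have La1P := L2M_Linfty La1 LP; have La2P := L2M_Linfty La2 LP.
have Lb1Q := L2M_Linfty Lb1 LQ; have Lb2Q := L2M_Linfty Lb2 LQ.
have PcP : P (fun z => a * (alpha1 z * P f z) + b * (alpha2 z * P f z)) =
    (fun z => c * P f z) %[ae mu].
  apply: P_unique; [by apply: L2D; exact: L2Z|exact: L2Z| |].
    move=> n n0; apply: ae_eq_fourier; [exact: L2Z|by apply: L2D; exact: L2Z|].
    by apply: filterS ac => z /(_ I) <- _; ring.
  have := H2_linear c 0 (P_H2 Lf) (P_H2 Lf) => -[_ +] n n0 => /(_ n n0).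
  by under [in X in X -> _]eq_fun do rewrite mul0r addr0.
have PcQ : P (fun z => a * (beta1 z * Q f z) + b * (beta2 z * Q f z)) =
    (fun=> 0) %[ae mu].
  apply: P_eq0; first by apply: L2D; exact: L2Z.
  move=> n n0; have <- : c * fourier (Q f) n + 0 * fourier (Q f) n = 0.
    by rewrite fourier_Q_ge0// !mulr0 addr0.
  rewrite -fourier_linear//; apply: ae_eq_fourier.
  - by apply: L2D; exact: L2Z.
  - by apply: L2D; exact: L2Z.
  - by apply: filterS bc => z /(_ I) <- _; ring.
have PlinP := P_linear a b La1P La2P; have PlinQ := P_linear a b Lb1Q Lb2Q.
have H1 : (fun z => a * P (fun z => alpha1 z * P f z) z + b * P (fun z => alpha2 z * P f z) z)
    = (fun z => c * P f z) %[ae mu].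
  by apply: filterS2 PcP PlinP => z /(_ I) <- /(_ I) <-.
have H2 : (fun z => a * P (fun z => beta1 z * Q f z) z + b * P (fun z => beta2 z * Q f z) z)
    = (fun=> 0) %[ae mu].
  by apply: filterS2 PcQ PlinQ => z /(_ I) <- /(_ I) <-.
have alg (A1 A2 B1 B2 u1 u2 p : R[i]) : a * A1 + b * A2 = c * p ->
    a * B1 + b * B2 = 0 -> a * u1 + b * u2 = c ->
    a * (B1 - (u1 * p - A1)) + b * (B2 - (u2 * p - A2)) = 0.
  move=> hA hB hu.
  transitivity (a * B1 + b * B2 + (a * A1 + b * A2) - (a * u1 + b * u2) * p).
    by ring.
  by rewrite hA hB hu add0r subrr.
apply: filterS3 H1 H2 ac => z /(_ I) h1 /(_ I) h2 /(_ I) h3 _.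
rewrite /defect [Q (fun z => alpha1 z * _) z]QE [Q (fun z => alpha2 z * _) z]QE.
exact: alg h1 h2 h3.
Qed.

(** Here [Q] kills the exponential and only [- Q (alpha z^n)] remains; it is expressed through [P]
    to match [P_mul_val]. *)
Lemma defect_exp_ge0 alpha beta n : Linfty alpha -> Linfty beta -> 0 <= n ->
  defect alpha beta (fun z => val z ^ n) =
  (fun z => P (fun z => alpha z * val z ^ n) z - alpha z * val z ^ n) %[ae mu].
Proof.
move=> La Lb n0; have Le := L2_exp (R := R) n.
have Pe := P_id (H2_exp (R := R) n0).
have Qe : Q (fun z => val z ^ n) = (fun=> 0 : R[i]) %[ae mu].
  by apply: filterS Pe => z /(_ I) e _; rewrite /Q e subrr.
have LaP := L2M_Linfty La (P_L2 Le); have Lae := L2M_Linfty La Le.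
have LbQ := L2M_Linfty Lb (Q_L2 Le).
have Pb : P (fun z => beta z * Q (fun z => val z ^ n) z) = (fun=> 0) %[ae mu].
  apply: P_eq0 => // k k0.
  rewrite (ae_eq_fourier k LbQ (L2_cst 0)).
    by rewrite fourier_cst; case: ifP.
  by apply: filterS Qe => z /(_ I) -> _; rewrite mulr0.
have Pa : P (fun z => alpha z * P (fun z => val z ^ n) z) =
    P (fun z => alpha z * val z ^ n) %[ae mu].
  by apply: P_ae_eq => //; apply: filterS Pe => z /(_ I) ->.
apply: filterS3 Pe Pb Pa => z /(_ I) e /(_ I) pb /(_ I) pa _.
by rewrite /defect [Q (fun z => alpha z * _) z]QE pb pa e sub0r opprB.
Qed.

Lemma defect_exp_lt0 alpha beta n : Linfty alpha -> Linfty beta -> n < 0 ->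
  defect alpha beta (fun z => val z ^ n) = P (fun z => beta z * val z ^ n) %[ae mu].
Proof.
move=> La Lb n0; have Le := L2_exp (R := R) n.
have Pe : P (fun z : circle R => val z ^ n) = (fun=> 0) %[ae mu].
  by apply: P_eq0 => // m m0; rewrite fourier_exp gt_eqF// (lt_le_trans n0).
have Qe : Q (fun z => val z ^ n) = (fun z => val z ^ n) %[ae mu].
  by apply: filterS Pe => z /(_ I) e _; rewrite /Q e subr0.
have LaP := L2M_Linfty La (P_L2 Le); have Lbe := L2M_Linfty Lb Le.
have LbQ := L2M_Linfty Lb (Q_L2 Le).
have Pa : P (fun z => alpha z * P (fun z => val z ^ n) z) = (fun=> 0) %[ae mu].
  apply: P_eq0 => // k k0.
  rewrite (ae_eq_fourier k LaP (L2_cst 0)).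
    by rewrite fourier_cst; case: ifP.
  by apply: filterS Pe => z /(_ I) -> _; rewrite mulr0.
have Pb : P (fun z => beta z * Q (fun z => val z ^ n) z) =
    P (fun z => beta z * val z ^ n) %[ae mu].
  by apply: P_ae_eq => //; apply: filterS Qe => z /(_ I) ->.
apply: filterS3 Pe Pb Pa => z /(_ I) e /(_ I) pb /(_ I) pa _.
by rewrite /defect [Q (fun z => alpha z * _) z]QE pb pa e mulr0 subrr subr0.
Qed.

(* Only [n != 0] matters: the defect ignores the other coefficients. *)
Definition off_coef alpha beta n :=
  if n < 0 then fourier alpha n else fourier beta n.

(** For [n < 0] the exponents [- n - 1] and [- n] are both nonnegative, for [n > 0] both negative,
    so one formula for the defect serves both; [n = 0] would straddle. The constant is the
    coefficient of index -1 of the symbol times [z^(- n - 1)], which is the symbol's coefficient of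
    index [n]. *)
Lemma defect_shift alpha beta n : Linfty alpha -> Linfty beta -> n != 0 ->
  defect alpha beta (fun z => val z ^ (- n)) =
  (fun z => val z * defect alpha beta (fun z => val z ^ (- n - 1)) z +
    off_coef alpha beta n) %[ae mu].
Proof.
move=> La Lb n0; rewrite /off_coef; have vS (z : circle R) : val z ^ (- n - 1) * val z ^ 1 = val z ^ (- n).
  by rewrite -val_expD subrK.
have [nlt0|nge0] := ltP n 0.
  have k0 : 0 <= - n - 1 by rewrite subr_ge0 -gtz0_ge1 oppr_gt0.
  have k1 : 0 <= - n by rewrite oppr_ge0 ltW.
  have Lak := L2M_Linfty La (L2_exp (- n - 1)).
  have := P_mul_val Lak; rewrite fourier_mul_exp (_ : -1 - (- n - 1) = n); last by ring.
  under [X in P X]eq_fun do rewrite -mulrA vS.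
  apply: filterS3 (defect_exp_ge0 La Lb k1) (defect_exp_ge0 La Lb k0).
  have alg (w X al m : R[i]) : w * X + fourier alpha n - al * (m * w) =
      w * (X - al * m) + fourier alpha n by ring.
  move=> z /(_ I) -> /(_ I) -> /(_ I) -> _.
  by rewrite -vS expr1z; exact: alg.
have npos : 0 < n by rewrite lt_neqAle eq_sym n0.
have k1 : - n < 0 by rewrite oppr_lt0.
have k0 : - n - 1 < 0 by rewrite (lt_trans _ k1)// gtrBl.
have Lbk := L2M_Linfty Lb (L2_exp (- n - 1)).
have := P_mul_val Lbk; rewrite fourier_mul_exp (_ : -1 - (- n - 1) = n); last by ring.
under [X in P X]eq_fun do rewrite -mulrA vS.
apply: filterS3 (defect_exp_lt0 La Lb k1) (defect_exp_lt0 La Lb k0).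
by move=> z /(_ I) -> /(_ I) -> /(_ I) -> _.
Qed.

Opaque defect off_coef.

(** Subtract [z] times the identity at exponent [- n - 1] from the one at [- n]: the defects cancel
    and the constants remain. *)
Lemma commute_off_coef alpha1 beta1 alpha2 beta2 n :
  Linfty alpha1 -> Linfty beta1 -> Linfty alpha2 -> Linfty beta2 ->
  commute_on_L2 (singular_op alpha1 beta1) (singular_op alpha2 beta2) ->
  n != 0 ->
  (fun z => (alpha1 z - beta1 z) * off_coef alpha2 beta2 n) =
  (fun z => (alpha2 z - beta2 z) * off_coef alpha1 beta1 n) %[ae mu].
Proof.
move=> La1 Lb1 La2 Lb2 /(commute_defect La1 Lb1 La2 Lb2) C n0.
have C0 := C _ (L2_exp (- n)); have C1 := C _ (L2_exp (- n - 1)).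
pose comm m z := (alpha1 z - beta1 z) * defect alpha2 beta2 (fun z => val z ^ m) z =
  (alpha2 z - beta2 z) * defect alpha1 beta1 (fun z => val z ^ m) z.
have C01 : \forall z \ae mu, comm (- n) z /\ comm (- n - 1) z.
  apply: filterS2 C0 C1 => z h0 h1; split; [exact: (h0 I)|exact: (h1 I)].
apply: filterS3 C01 (defect_shift La1 Lb1 n0) (defect_shift La2 Lb2 n0).
move=> z [c0 c1] /(_ I) s1 /(_ I) s2 _.
have cancel_shift (d1 d2 w E1 E2 k1 k2 : R[i]) : d1 * E2 = d2 * E1 ->
    d1 * (w * E2 + k2) = d2 * (w * E1 + k1) -> d1 * k2 = d2 * k1.
  move=> e e'; transitivity (d1 * (w * E2 + k2) - w * (d1 * E2)); first by ring.
  by rewrite e e'; ring.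
move: c0 c1; rewrite /comm s1 s2 => c0 c1; exact: cancel_shift c1 c0.
Qed.

End commutation.

Theorem theorem6p3 (R : realType) (alpha1 beta1 alpha2 beta2 : circle R -> R[i])
    (halpha1 : Linfty alpha1) (hbeta1 : Linfty beta1)
    (halpha2 : Linfty alpha2) (hbeta2 : Linfty beta2) :
  commute_on_L2 (singular_op alpha1 beta1) (singular_op alpha2 beta2) <->
  [\/ [/\ analytic alpha1, analytic alpha2, coanalytic beta1 & coanalytic beta2],
      alpha1 = beta1 %[ae circle_measure R] /\
      alpha2 = beta2 %[ae circle_measure R]
    | exists a b c : R[i],
        [/\ a != 0 \/ b != 0,
            (fun z => a * alpha1 z + b * alpha2 z) = (fun=> c)
              %[ae circle_measure R]
          & (fun z => a * beta1 z + b * beta2 z) = (fun=> c)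
              %[ae circle_measure R]]].
Proof.
have La1 := Linfty_L2 halpha1; have Lb1 := Linfty_L2 hbeta1.
have La2 := Linfty_L2 halpha2; have Lb2 := Linfty_L2 hbeta2.
split; last first.
  move=> H; apply/commute_defect => // f Lf.
  case: H => [[aa1 aa2 cb1 cb2]|[e1 e2]|[a [b [c [ab0 ac bc]]]]].
  - apply: filterS2 (defect_analytic halpha1 hbeta1 aa1 cb1 Lf)
      (defect_analytic halpha2 hbeta2 aa2 cb2 Lf).
    by move=> z /(_ I) -> /(_ I) -> _; rewrite !mulr0.
  - by apply: filterS2 e1 e2 => z /(_ I) -> /(_ I) -> _; rewrite !subrr !mul0r.
  have D := defect_linear halpha1 hbeta1 halpha2 hbeta2 Lf ac bc.
  apply: filterS3 ac bc D => z /(_ I) za /(_ I) zb /(_ I).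
  move: (defect alpha1 _ _ _) (defect alpha2 _ _ _) => E1 E2 aE _.
  have ad : a * (alpha1 z - beta1 z) + b * (alpha2 z - beta2 z) = 0.
    by rewrite !mulrBr addrACA -opprD za zb subrr.
  move: (alpha1 z - beta1 z) (alpha2 z - beta2 z) ad => d1 d2 ad.
  (* Multiplied by [a] or by [b], the determinant [d1 E2 - d2 E1] becomes a combination of the two
     vanishing sums. *)
  apply/eqP; rewrite -subr_eq0; apply/eqP.
  case: ab0 => [a0|b0].
    apply: (mulfI a0); rewrite mulr0.
    transitivity ((a * d1 + b * d2) * E2 - d2 * (a * E1 + b * E2)); first by ring.
    by rewrite ad aE mul0r mulr0 subrr.
  apply: (mulfI b0); rewrite mulr0.
  transitivity (d1 * (a * E1 + b * E2) - (a * d1 + b * d2) * E1); first by ring.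
  by rewrite ad aE mul0r mulr0 subrr.
move=> C; have off n := @commute_off_coef _ _ _ _ _ n halpha1 hbeta1 halpha2 hbeta2 C.
pose c1 := off_coef alpha1 beta1; pose c2 := off_coef alpha2 beta2.
have analytic_of alpha beta : L2 alpha -> (forall n, n != 0 -> off_coef alpha beta n = 0) ->
    analytic alpha.
  move=> La c0; split=> // n n0.
  by have := c0 n; rewrite /off_coef n0 lt_eqF//; exact.
have coanalytic_of alpha beta : L2 beta -> (forall n, n != 0 -> off_coef alpha beta n = 0) ->
    coanalytic beta.
  move=> Lb c0; split=> [|n n0]; first exact: L2_conj.
  rewrite fourier_conj//; have := c0 (- n).
  by rewrite /off_coef oppr_lt0 ltNge (ltW n0)/= oppr_eq0 lt_eqF// => ->//; rewrite conjc0.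
have [c0|] := pselect (forall n, n != 0 -> c1 n = 0 /\ c2 n = 0).
  have c10 n (n0 : n != 0) := (c0 n n0).1; have c20 n (n0 : n != 0) := (c0 n n0).2.
  by constructor 1; split; [exact: analytic_of c10|exact: analytic_of c20|
    exact: coanalytic_of c10|exact: coanalytic_of c20].
move=> /existsNP[m /not_implyP[m0 cm]].
have [[e1 e2]|d0] := pselect (alpha1 = beta1 %[ae circle_measure R] /\
  alpha2 = beta2 %[ae circle_measure R]); first by constructor 2.
constructor 3; exists (c2 m), (- c1 m).
have prop n : n != 0 -> c2 m * c1 n + - c1 m * c2 n = 0.
  (* Cramer's rule: if the coefficient pairs at [m] and [n] were independent, the two relations
     would force both differences to vanish, which is case (ii). *)
  move=> n0; apply: contrapT => /eqP D0; apply: d0.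
  have z0 : {ae circle_measure R, forall z,
      alpha1 z - beta1 z = 0 /\ alpha2 z - beta2 z = 0}.
    have alg (d1 d2 u1 u2 v1 v2 : R[i]) : u2 * v1 + - u1 * v2 != 0 ->
        d1 * u2 = d2 * u1 -> d1 * v2 = d2 * v1 -> d1 = 0 /\ d2 = 0.
      move=> D eu ev; split; apply: (mulIf D); rewrite mul0r.
        transitivity (d1 * u2 * v1 - u1 * (d1 * v2)); first by ring.
        by rewrite eu ev; ring.
      transitivity (u2 * (d2 * v1) - d2 * u1 * v2); first by ring.
      by rewrite -eu -ev; ring.
    apply: filterS2 (off _ m0) (off _ n0) => z /(_ I) om /(_ I) on.
    exact: alg D0 om on.
  by split; apply: filterS z0 => z [] /eqP + /eqP +; rewrite !subr_eq0 => /eqP ? /eqP ?.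
set a := c2 m; set b := - c1 m.
have Lh : L2 (fun z => a * alpha1 z + b * alpha2 z) by apply: L2D; exact: L2Z.
have Lh' : L2 (fun z => a * beta1 z + b * beta2 z) by apply: L2D; exact: L2Z.
(* The relation at [m] says that the combination of the [alpha]s and that of the [beta]s coincide.
   The first controls the negative indices, the second the positive ones. *)
have hh' : (fun z => a * alpha1 z + b * alpha2 z) = (fun z => a * beta1 z + b * beta2 z)
    %[ae circle_measure R].
  have alg (x y u v s t : R[i]) : (x - y) * s = (u - v) * t -> s * x + - t * u = s * y + - t * v.
    move=> e; apply/eqP; rewrite -subr_eq0; apply/eqP.
    transitivity ((x - y) * s - (u - v) * t); first by ring.
    by rewrite e subrr.
  by apply: filterS (off _ m0) => z /(_ I) /alg.
(* The zeroth coefficient is the only one that the relations leave free, so it has to be the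
   constant. *)
set c := fourier (fun z => a * alpha1 z + b * alpha2 z) 0.
have hc : (fun z => a * alpha1 z + b * alpha2 z) = (fun=> c) %[ae circle_measure R].
  apply: ae_eq_of_fourier => // [|n]; first exact: L2_cst.
  rewrite fourier_cst; case: eqVneq => [->//|n0].
  have c1E : c1 n = if n < 0 then fourier alpha1 n else fourier beta1 n by rewrite /c1 /off_coef.
  have c2E : c2 n = if n < 0 then fourier alpha2 n else fourier beta2 n by rewrite /c2 /off_coef.
  (* For [n < 0] proportionality already speaks of the [alpha]s; for [n > 0] it speaks of the
     [beta]s and is transferred by [hh']. *)
  have := prop n n0; rewrite c1E c2E -/a -/b; case: ltP => n0' p0.
    by rewrite fourier_linear.
  by rewrite (ae_eq_fourier n Lh Lh' hh') fourier_linear.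
exists c; split=> //.
- have [a0|a0] := eqVneq a 0; last by left.
  right; rewrite oppr_eq0; apply/eqP => b0; apply: cm; split=> //.
- by apply: filterS2 hh' hc => z /(_ I) <- /(_ I) ->.
Qed.
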